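(* Let $a\in(\mathrm{L}^1\cap\mathrm{BV})(0,T)$, let $u$ be the entropy solution of the initial-boundary value problem $$u_t+f(u)_x=0\ \text{ in }(0,L)\times(0,T),\qquad u(x,0)=u_0(x),\ x\in(0,L),\qquad u(0,t)=a(t),\ t\in(0,T),$$ and let $u_{\Delta t}$ be the numerical approximation given by $$u_j^{n+1}=u_j^n-\lambda\big(f(u_j^n)-f(u_{j-1}^n)\big),\ j\ge1,\ n\ge0;\qquad u_j^0=\frac1{\Delta x}\int_{\mathcal{C}_j}u_0(x)\,dx,\ j\ge0;\qquad u_0^n=\frac1{\Delta t}\int_{\mathcal{C}^n}a(s)\,ds,\ n\ge1.$$ Then $$\|u(\cdot,T)-u_{\Delta t}(\cdot,T)\|_{\mathrm{L}^1(0,L)}\le C\sqrt{\Delta x}$$ for some constant $C$ independent of $\Delta x$.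
   Context: $T,L>0$; $u_0\in(\mathrm{L}^1\cap\mathrm{BV})(0,L)$; $f\in C^1(\mathbb{R})$ with $f'\ge\alpha>0$. Entropy solution: $u\in\mathcal{C}([0,T];\mathrm{L}^1(0,L))\cap\mathrm{L}^\infty((0,L)\times(0,T))$, with spatial traces $u(0+,t)$, $u(L-,t)$, such that for all $c\in\mathbb{R}$ and all nonnegative $\varphi\in\mathcal{C}^\infty([0,L]\times[0,T])$, $$\int_0^T\!\!\int_0^L\big(|u-c|\varphi_t+|f(u)-f(c)|\varphi_x\big)dx\,dt-\int_0^L|u(x,T)-c|\varphi(x,T)dx+\int_0^L|u_0(x)-c|\varphi(x,0)dx$$ $$+\int_0^T|f(u(0+,t))-f(c)|\varphi(0,t)dt-\int_0^T|f(u(L-,t))-f(c)|\varphi(L,t)dt\ge0,$$ and $u(0+,t)=a(t)$ for almost every $t\in(0,T)$. Grid: $\mathcal{C}_j=(j\Delta x,(j+1)\Delta x)$ for $0\le j<L/\Delta x$, where $L/\Delta x$ is an integer; $t^n=n\Delta t$, $\mathcal{C}^n=(t^n,t^{n+1})$, $T=(M+1)\Delta t$; $\lambda=\Delta t/\Delta x$ is a fixed constant. The numerical approximation is $u_{\Delta t}(x,t)=u_j^n$ for $x\in\mathcal{C}_j$, $t\in[t^n,t^{n+1})$, and $u_{\Delta t}(x,T)=u_j^{M+1}$ on $\mathcal{C}_j$; at the final time, where $a$ is not defined on $\mathcal{C}^{M+1}$, use $u_0^{M+1}:=u_0^M$. CFL condition: $\lambda\max_u f'(u)\le1$, the maximum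 being over the smallest closed interval containing the essential ranges of $u_0$ and $a$. *)

(* Defs.v *)
From mathcomp Require Import all_boot all_order all_algebra.
From mathcomp Require Import all_classical all_reals all_analysis.

Set Implicit Arguments.
Unset Strict Implicit.
Unset Printing Implicit Defensive.

Import Order.TTheory GRing.Theory Num.Theory.
Import numFieldNormedType.Exports.

Local Open Scope classical_set_scope.
Local Open Scope ring_scope.

Section defs.
Context {R : realType}.
Local Notation mu := (@lebesgue_measure R).

(* Functions on an interval are total functions on R; only their values on the
   open interval matter, and only up to null sets. In particular, membership in
   BV is finiteness of the total variation of some almost-everywhere
   representative. *)
Definition L1_BV (p q : R) (g : R -> R) : Prop :=
  mu.-integrable `]p, q[ (EFin \o g) /\
  exists2 h : R -> R, {ae mu, forall x, x \in `]p, q[ -> g x = h x} &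
    bounded_variation p q h.

Definition C1 (f : R -> R) : Prop :=
  (forall v, derivable f v 1) /\ continuous (derive1 f).

Fixpoint Ck2 (k : nat) (phi : R * R -> R) : Prop :=
  if k is k'.+1 then
    [/\ continuous phi,
        forall z, derivable phi z (1, 0), forall z, derivable phi z (0, 1),
        Ck2 k' ('D_(1, 0) phi) & Ck2 k' ('D_(0, 1) phi)]
  else continuous phi.

(* Smooth functions on the closed rectangle [0, L] x [0, T] are the restrictions
   of smooth functions on the plane (Whitney, Seeley). *)
Definition nonneg_test (L T : R) (phi : R * R -> R) : Prop :=
  (forall k, Ck2 k phi) /\
  forall x t, x \in `[0, L] -> t \in `[0, T] -> 0 <= phi (x, t).

Definition in_C_L1 (L T : R) (u : R -> R -> R) : Prop :=
  (forall t, t \in `[0, T] ->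
     mu.-integrable `]0, L[ (fun x => (u x t)%:E)) /\
  (forall t, t \in `[0, T] ->
     (\int[mu]_(x in `]0%R, L[) (`|u x s - u x t|)%:E)%E
       @[s --> within `[0, T] (nbhs t)] --> 0%E).

Definition in_Linfty (L T : R) (u : R -> R -> R) : Prop :=
  measurable_fun (`]0, L[ `*` `]0, T[) (fun z : R * R => u z.1 z.2) /\
  exists K : R, {ae (mu \x mu)%E, forall z : R * R,
    z.1 \in `]0, L[ -> z.2 \in `]0, T[ -> `|u z.1 z.2| <= K}.

(* Strong trace along a filter F of positions (F = 0^'+ or F = L^'-): the
   essential limit (limit off a null set) of u(x, .) in L^1(0, T). *)
Definition is_trace (T : R) (u : R -> R -> R) (F : set_system R)
    (gam : R -> R) : Prop :=
  measurable_fun `]0, T[ gam /\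
  exists2 N : set R, mu.-negligible N &
    (\int[mu]_(t in `]0%R, T[) (`|u x t - gam t|)%:E)%E
      @[x --> within (~` N) F] --> 0%E.

(* gam0 and gamL stand for u(0+, .) and u(L-, .). *)
Definition entropy_inequality (L T : R) (f u0 : R -> R) (u : R -> R -> R)
    (gam0 gamL : R -> R) : Prop :=
  forall (c : R) (phi : R * R -> R), nonneg_test L T phi ->
    0 <= \int[mu]_(t in `]0, T[) \int[mu]_(x in `]0, L[)
             (`|u x t - c| * 'D_(0, 1) phi (x, t)
              + `|f (u x t) - f c| * 'D_(1, 0) phi (x, t))
       - \int[mu]_(x in `]0, L[) (`|u x T - c| * phi (x, T))
       + \int[mu]_(x in `]0, L[) (`|u0 x - c| * phi (x, 0))
       + \int[mu]_(t in `]0, T[) (`|f (gam0 t) - f c| * phi (0, t))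
       - \int[mu]_(t in `]0, T[) (`|f (gamL t) - f c| * phi (L, t)).

Definition entropy_solution (L T : R) (f u0 a : R -> R) (u : R -> R -> R)
    : Prop :=
  [/\ in_C_L1 L T u, in_Linfty L T u &
      exists gam0 gamL : R -> R,
        [/\ is_trace T u 0^'+ gam0, is_trace T u L^'- gamL,
            entropy_inequality L T f u0 u gam0 gamL &
            {ae mu, forall t, t \in `]0, T[ -> gam0 t = a t}]].

Definition ess_range (p q : R) (g : R -> R) : set R :=
  [set y | forall e : R, 0 < e ->
     (0 < mu (`]p, q[ `&` g @^-1` ball y e))%E].

Definition data_interval (L T : R) (u0 a : R -> R) : set R :=
  \bigcap_(I in [set I : R * R |
      ess_range 0 L u0 `|` ess_range 0 T a `<=` [set` `[I.1, I.2]]])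
    [set` `[I.1, I.2]].

(* The mean value over the k-th cell (k h, (k + 1) h) of a grid of step h. *)
Definition cell_mean (h : R) (g : R -> R) (k : nat) : R :=
  h^-1 * \int[mu]_(x in `]k%:R * h, k.+1%:R * h[) g x.

(* upwind f u0 a lambda dx dt M n j is u_j^n. The boundary datum lives on the
   time cells 0, ..., M only; at level M.+1 the boundary value of level M is
   repeated. *)
Fixpoint upwind (f u0 a : R -> R) (lambda dx dt : R) (M n j : nat) : R :=
  if n is n'.+1 then
    let v := upwind f u0 a lambda dx dt M n' in
    if j is j'.+1 then v j - lambda * (f (v j) - f (v j'))
    else if (n <= M)%N then cell_mean dt a n else v 0%N
  else cell_mean dx u0 j.

(* For x, t >= 0, truncn (x / dx) and truncn (t / dt) are the indices of the
   half-open space and time cells containing x and t; at t = T = M.+1 * dt the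
   time index is M.+1. *)
Definition upwind_approx (f u0 a : R -> R) (lambda dx dt : R) (M : nat)
    (x t : R) : R :=
  upwind f u0 a lambda dx dt M (Num.truncn (t / dt)) (Num.truncn (x / dx)).

End defs.

(* Main.v *)
Require Import Defs.
From mathcomp Require Import all_boot all_order all_algebra.
From mathcomp Require Import all_classical all_reals all_analysis.
From mathcomp Require Import measurable_realfun.
From mathcomp Require Import ring lra.

(** The proof doubles the variables in the manner of Kuznetsov: the entropy
solution [u] is compared, at [(x, t)], with the grid values [w n j] of the
cells close to [(x, t)]. The entropy inequality is written for each cell, with
the constant [w n j] and a test function that is the weight of the cell in a
smooth average of width [eps] around [(x, t)], and these inequalities are
added ([entropy_sum]). The kernel of the average is one-sided, supported on
cells to the right of [x] and later than [t]. As information travels in the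
same directions (here [f' > 0] is used), the lines [x = 0] and [t = 0] only
contribute averages of the data against grid values, while at [t = T] the
weights of the cells, continued past [T] and [L], still add up to 1 and give
the error itself. So all errors of smoothing are moduli of continuity of the
grid values.

Inside the rectangle, summation by parts moves the derivatives of the test
functions onto the grid values, where the discrete entropy inequality
[scheme_kruzkov] holds against every constant; what remains is the difference
between a weight and [dx] or [dt] times the kernel, of relative size [dx / eps]
([discrete_entropy_production], [interior_integral_le]). On the lines [t = T],
[t = 0] and [x = 0] the smoothing costs [eps] times the variation of the grid
values along the line ([terminal_le], [initial_le], [inflow_le]). The variation
in space is controlled by the data ([scheme_TV_space]); so is the variation in
time of the flux through a vertical line ([scheme_TV_time_flux]), and the lower
bound [alpha] of [f'] turns it into a bound for the variation of the grid
values ([scheme_flux_L1_space]). The choice [eps = sqrt dx] balances the two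
kinds of error. *)

Set Implicit Arguments.
Unset Strict Implicit.
Unset Printing Implicit Defensive.

Import Order.TTheory GRing.Theory Num.Theory.
Import numFieldNormedType.Exports.

Local Open Scope classical_set_scope.
Local Open Scope ring_scope.

(** * The upwind scheme *)

(** The upwind recursion for arbitrary initial values [U] and boundary values
[A], on an unbounded grid. *)
Fixpoint scheme {R : numDomainType} (f : R -> R) (lam : R) (U A : nat -> R)
    (n j : nat) : R :=
  if n is n'.+1 then
    if j is j'.+1 then
      scheme f lam U A n' j
      - lam * (f (scheme f lam U A n' j) - f (scheme f lam U A n' j'))
    else A n
  else U j.

Section scheme.
Context {R : realFieldType}.
Variables (f : R -> R) (lam : R) (D : R -> Prop).
Hypothesis lam_gt0 : 0 < lam.
Hypothesis f_ndecr : {homo f : x y / x <= y}.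
Hypothesis D_convex : forall x y z, D x -> D y -> x <= z <= y -> D z.
Hypothesis cfl : forall x y, D x -> D y -> x <= y -> lam * (f y - f x) <= y - x.

Lemma flux_mono x y : x <= y -> 0 <= lam * (f y - f x).
Proof. by move=> xy; rewrite mulr_ge0 ?(ltW lam_gt0)// subr_ge0 f_ndecr. Qed.

(** One step never leaves the segment between the two states that it
combines. *)
Lemma upwind_step_in x y : D x -> D y -> D (y - lam * (f y - f x)).
Proof.
move=> Dx Dy; have [xy|/ltW yx] := leP x y.
  apply: (D_convex Dx Dy).
  have := flux_mono xy; have := cfl Dx Dy xy; lra.
apply: (D_convex Dy Dx).
have := flux_mono yx; have := cfl Dy Dx yx; lra.
Qed.

(** If [k] lies below both states, or above both, then it lies on the same side
of the new state, and the inequality is the scheme itself. Otherwise [k] lies between them,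
hence in [D], where the CFL condition makes [x |-> x - lam * f x]
nondecreasing. *)
Lemma upwind_step_kruzkov x y k : D x -> D y ->
  `|y - lam * (f y - f x) - k| <=
  `|y - k| - lam * (`|f y - f k| - `|f x - f k|).
Proof.
move=> Dx Dy.
have nf a b : a <= b -> `|f b - f a| = f b - f a.
  by move=> ab; rewrite ger0_norm// subr_ge0 f_ndecr.
have nf' a b : a <= b -> `|f a - f b| = f b - f a.
  by move=> ab; rewrite distrC nf.
have H1 := @flux_mono; have H2 := cfl.
have [ky|/ltW yk] := leP k y; have [kx|/ltW xk] := leP k x.
- rewrite (nf _ _ ky) (nf _ _ kx) (ger0_norm (_ : 0 <= y - k)) ?subr_ge0//.
  rewrite ger0_norm; first lra.
  have [xy|/ltW yx] := leP x y.
    by have := H2 _ _ Dx Dy xy; lra.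
  by have := H1 _ _ yx; lra.
- have Dk : D k by apply: (D_convex Dx Dy); rewrite xk ky.
  rewrite (nf _ _ ky) (nf' _ _ xk) (ger0_norm (_ : 0 <= y - k)) ?subr_ge0//.
  have := H2 _ _ Dk Dy ky; have := H1 _ _ ky; have := H1 _ _ xk.
  by move=> ? ? ?; rewrite ler_norml; apply/andP; split; lra.
- have Dk : D k by apply: (D_convex Dy Dx); rewrite yk kx.
  rewrite (nf' _ _ yk) (nf _ _ kx) (ler0_norm (_ : y - k <= 0)) ?subr_le0//.
  have := H2 _ _ Dy Dk yk; have := H1 _ _ yk; have := H1 _ _ kx.
  by move=> ? ? ?; rewrite ler_norml; apply/andP; split; lra.
- rewrite (nf' _ _ yk) (nf' _ _ xk) (ler0_norm (_ : y - k <= 0)) ?subr_le0//.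
  rewrite ler0_norm; first lra.
  have [xy|/ltW yx] := leP x y.
    by have := H1 _ _ xy; lra.
  by have := H2 _ _ Dy Dx yx; lra.
Qed.

(** This is the incremental form of the scheme: one step replaces a state by a
convex combination of itself and of its left neighbour. *)
Lemma flux_fraction x y : D x -> D y ->
  exists2 th, 0 <= th <= 1 & lam * (f y - f x) = th * (y - x).
Proof.
move=> Dx Dy; have [->|xy] := eqVneq y x.
  by exists 0; [rewrite lexx ler01|rewrite !subrr mulr0 mul0r].
have yx0 : y - x != 0 by rewrite subr_eq0.
exists (lam * (f y - f x) / (y - x)); last by rewrite divfK.
have [lxy|lyx|exy] := ltgtP x y; last by rewrite exy eqxx in xy.
- have p : 0 < y - x by rewrite subr_gt0.
  by rewrite ler_pdivlMr// ler_pdivrMr// mul0r mul1r flux_mono ?cfl ?(ltW lxy).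
- have p : y - x < 0 by rewrite subr_lt0.
  rewrite ler_ndivlMr// ler_ndivrMr// mul0r mul1r.
  have := flux_mono (ltW lyx); have := cfl Dy Dx (ltW lyx) => ? ?.
  by apply/andP; split; lra.
Qed.

(** The increment [y' - y] keeps a part of itself and receives what the
increment [x' - x] loses. With [x' = y] these are increments in space; with
[x, y] and [x', y'] at consecutive times they are increments in time. *)
Lemma increment_redistribution x y x' y' :
  D x -> D y -> D x' -> D y' ->
  `|(y' - lam * (f y' - f x')) - (y - lam * (f y - f x))| <=
  `|y' - y| - lam * `|f y' - f y| + lam * `|f x' - f x|.
Proof.
move=> Dx Dy Dx' Dy'.
have -> : (y' - lam * (f y' - f x')) - (y - lam * (f y - f x)) =
  ((y' - y) - lam * (f y' - f y)) + lam * (f x' - f x) by ring.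
rewrite (le_trans (ler_normD _ _))//.
rewrite [X in _ + X <= _]normrM (gtr0_norm lam_gt0) lerD2r.
have [th /andP[th0 th1] e] := flux_fraction Dy Dy'.
have -> : lam * `|f y' - f y| = th * `|y' - y|.
  by rewrite -{1}(gtr0_norm lam_gt0) -normrM e normrM ger0_norm.
rewrite e -{1}[y' - y]mul1r -mulrBl normrM ger0_norm ?subr_ge0//.
by rewrite mulrBl mul1r.
Qed.

Variables U A : nat -> R.
Hypothesis U_in : forall j, D (U j).
Hypothesis A_in : forall n, D (A n).
Let w := scheme f lam U A.

Lemma scheme_in n j : D (w n j).
Proof.
rewrite /w; elim: n j => [|n IH] [|j]//=; exact: upwind_step_in.
Qed.

Lemma scheme_kruzkov k n j :
  `|w n.+1 j.+1 - k| <=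
  `|w n j.+1 - k| - lam * (`|f (w n j.+1) - f k| - `|f (w n j) - f k|).
Proof. by apply: upwind_step_kruzkov; exact: scheme_in. Qed.

Lemma scheme_time_increment n j :
  `|w n.+1 j.+1 - w n j.+1| = lam * `|f (w n j.+1) - f (w n j)|.
Proof.
rewrite /w/= -/w addrAC subrr add0r normrN normrM gtr0_norm//.
Qed.

Lemma flux_increment_le n m i j :
  lam * `|f (w n j) - f (w m i)| <= `|w n j - w m i|.
Proof.
have [th /andP[th0 th1] e] := flux_fraction (scheme_in m i) (scheme_in n j).
rewrite -{1}(gtr0_norm lam_gt0) -normrM e normrM ger0_norm//.
by rewrite ler_piMl.
Qed.

(** Increments move to the right: what they lose at [J] up to time [n] is the
second term on the left, and the induction on [J] needs to keep track of it. *)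
Lemma scheme_TV_space_flux n J :
  \sum_(j < J) `|w n j.+1 - w n j| +
    (if J is J'.+1 then \sum_(m < n) lam * `|f (w m J) - f (w m J')| else 0) <=
  \sum_(j < J) `|U j.+1 - U j| + \sum_(m < n) `|w m.+1 0 - w m 0|.
Proof.
elim: n J => [|n IH] J.
  rewrite !big_ord0 addr0; case: J => [|J]; rewrite ?addr0//.
  by rewrite big_ord0 addr0.
rewrite [in X in _ <= X]big_ord_recr/= addrA.
case: J (IH J) => [|J] IHJ.
  by rewrite !big_ord0 !add0r addr_ge0// sumr_ge0.
rewrite (le_trans _ (lerD IHJ (lexx _)))//.
rewrite [X in _ + X <= _]big_ord_recr/=.
rewrite addrA [X in _ <= X]addrAC [X in X <= _]addrAC lerD2r.
elim: J {IHJ} => [|J IHJ].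
  rewrite !big_ord_recr !big_ord0/= !add0r -/w.
  have -> : w n 1 - lam * (f (w n 1) - f (w n 0)) - A n.+1 =
    (w n 1 - w n 0 - lam * (f (w n 1) - f (w n 0))) + (w n 0 - A n.+1) by ring.
  have [th /andP[th0 th1] e] := flux_fraction (scheme_in n 0) (scheme_in n 1).
  have -> : lam * `|f (w n 1) - f (w n 0)| = th * `|w n 1 - w n 0|.
    by rewrite -{1}(gtr0_norm lam_gt0) -normrM e normrM ger0_norm.
  rewrite e -[X in `|X - _ + _|]mul1r -mulrBl [`|A _ - _|]distrC.
  have := ler_normD ((1 - th) * (w n 1 - w n 0)) (w n 0 - A n.+1).
  rewrite normrM (ger0_norm (_ : 0 <= 1 - th)) ?subr_ge0//; lra.
rewrite big_ord_recr [in X in _ <= X]big_ord_recr/=.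
have := increment_redistribution (scheme_in n J) (scheme_in n J.+1)
  (scheme_in n J.+1) (scheme_in n J.+2).
rewrite -/w; move: IHJ => /=; rewrite -/w; lra.
Qed.

Variable V : R.
Hypothesis data_TV : forall J n,
  \sum_(j < J) `|U j.+1 - U j| + \sum_(m < n) `|w m.+1 0 - w m 0| <= V.

Lemma scheme_TV_space n J : \sum_(j < J) `|w n j.+1 - w n j| <= V.
Proof.
rewrite (le_trans _ (data_TV J n))// (le_trans _ (scheme_TV_space_flux n J))//.
rewrite lerDl; case: J => // J; apply: sumr_ge0 => m _.
by rewrite mulr_ge0 // ltW.
Qed.

Lemma data_TV_ge0 : 0 <= V.
Proof. by have := data_TV 0 0; rewrite !big_ord0 addr0. Qed.

Lemma scheme_increment_boundary n : `|w n.+1 0 - w n 0| <= V.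
Proof.
rewrite (le_trans _ (data_TV 0 n.+1))// big_ord0 add0r big_ord_recr/=.
by rewrite lerDr sumr_ge0.
Qed.

Lemma scheme_L1_time n J : \sum_(j < J) `|w n.+1 j - w n j| <= V *+ 2.
Proof.
case: J => [|J]; first by rewrite big_ord0 mulrn_wge0// data_TV_ge0.
rewrite big_ord_recl mulr2n lerD ?scheme_increment_boundary//.
rewrite (le_trans _ (scheme_TV_space n J))// ler_sum// => j _.
rewrite scheme_time_increment; exact: flux_increment_le.
Qed.

(** Time and space play symmetric roles once the flux is the unknown: the flux
through a vertical line varies in time no more than the data. *)
Lemma scheme_TV_time_flux n j :
  \sum_(m < n) lam * `|f (w m.+1 j) - f (w m j)| <= V.
Proof.
pose G n j := \sum_(m < n) lam * `|f (w m.+1 j) - f (w m j)|.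
suff H : G n j + `|w n.+1 j - w n j| <=
    \sum_(i < j) `|U i.+1 - U i| + \sum_(m < n.+1) `|w m.+1 0 - w m 0|.
  by rewrite (le_trans _ (data_TV j n.+1))// (le_trans _ H)// lerDl.
rewrite {}/G; elim: j => [|j IHj].
  rewrite big_ord0 add0r [X in _ <= X]big_ord_recr/= lerD2r.
  by apply: ler_sum => m _; exact: flux_increment_le.
have G_step m : \sum_(i < m) lam * `|f (w i.+1 j.+1) - f (w i j.+1)| +
    `|w m.+1 j.+1 - w m j.+1| <= `|w 1%N j.+1 - w 0%N j.+1| +
    \sum_(i < m) lam * `|f (w i.+1 j) - f (w i j)|.
  elim: m => [|m IHm]; first by rewrite !big_ord0 addrC.
  rewrite !big_ord_recr/=.
  have := increment_redistribution (scheme_in m j) (scheme_in m j.+1)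
    (scheme_in m.+1 j) (scheme_in m.+1 j.+1).
  move: IHm; rewrite /= -/w; lra.
rewrite (le_trans (G_step n))// big_ord_recr/=.
have : `|w 1%N j.+1 - w 0%N j.+1| <= `|U j.+1 - U j|.
  by rewrite scheme_time_increment; exact: flux_increment_le.
have := normr_ge0 (w n.+1 j - w n j); move: IHj.
rewrite /= -/w; lra.
Qed.

Variable alpha : R.
Hypothesis alpha_gt0 : 0 < alpha.
Hypothesis f_incr : forall x y, x <= y -> alpha * (y - x) <= f y - f x.

Lemma flux_expansive x y : alpha * `|y - x| <= `|f y - f x|.
Proof.
wlog xy : x y / x <= y.
  by move=> H; have [/H//|/ltW/H] := leP x y; rewrite distrC [X in _ <= X]distrC.
by rewrite !ger0_norm ?subr_ge0 ?f_incr// f_ndecr.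
Qed.

Lemma scheme_TV_time n j :
  \sum_(m < n) `|w m.+1 j - w m j| <= V / (lam * alpha).
Proof.
rewrite ler_pdivlMr ?mulr_gt0// mulr_suml (le_trans _ (scheme_TV_time_flux n j))//.
apply: ler_sum => m _; rewrite [X in X <= _]mulrC -mulrA ler_pM2l//.
exact: flux_expansive.
Qed.

Lemma scheme_flux_L1_space n j :
  \sum_(m < n) `|f (w m j.+1) - f (w m j)| <= V / (lam * alpha) / lam.
Proof.
rewrite ler_pdivlMr// mulr_suml (le_trans _ (scheme_TV_time n j.+1))//.
by apply: ler_sum => m _; rewrite mulrC scheme_time_increment.
Qed.

End scheme.

(** * Local averages of a grid function *)

Section local_average.
Context {R : realFieldType}.

Lemma telescope_le (h : nat -> R) i j K : (i <= j <= i + K)%N ->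
  `|h j - h i| <= \sum_(k < K) `|h (i + k).+1 - h (i + k)%N|.
Proof.
elim: K j => [|K IH] j /andP[ij jiK].
  by rewrite addn0 in jiK; rewrite (@anti_leq i j) ?ij// subrr normr0 big_ord0.
rewrite big_ord_recr/=; move: jiK; rewrite leq_eqVlt => /orP[/eqP->|jiK].
  rewrite addnS (le_trans (ler_distD (h (i + K)%N) _ _))// [leRHS]addrC lerD2l.
  by rewrite IH// leq_addr leqnn.
by rewrite (le_trans (IH j _)) ?lerDl// ij/= -ltnS -addnS.
Qed.

Variables (g : nat -> nat -> R) (K K' P Q : nat).

(** A bound for [g p q - g p0 q0], uniform in [q] in the window of [K] steps
after [q0] and for [p] in the window of [K'] steps after [p0]. It may depend on
[p], which is averaged afterwards, but not on [q], over which it is summed. *)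
Definition window_var p0 q0 p :=
  \sum_(k < K) `|g p (q0 + k).+1 - g p (q0 + k)%N| +
  \sum_(k < K') `|g (p0 + k).+1 q0 - g (p0 + k)%N q0|.

Variables (psi chi : nat -> R) (p0 : nat).
Hypotheses (chi_ge0 : forall p, 0 <= chi p)
  (chi_supp : forall p, (p < P)%N -> chi p != 0 -> (p0 <= p <= p0 + K')%N).
Hypothesis chi1 : \sum_(p < P) chi p = 1.

Definition window_avg q0 := \sum_(p < P) chi p * window_var p0 q0 p.

Section pointwise.
Variable q0 : nat.
Hypotheses (psi_ge0 : forall q, 0 <= psi q)
  (psi_supp : forall q, (q < Q)%N -> psi q != 0 -> (q0 <= q <= q0 + K)%N).
Hypothesis psi1 : \sum_(q < Q) psi q = 1.

Lemma avg_window_var :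
  \sum_(q < Q) \sum_(p < P) `|g p q - g p0 q0| * (psi q * chi p) <=
  window_avg q0.
Proof.
rewrite exchange_big/=; apply: ler_sum => p _.
rewrite -[X in _ <= X * _]mul1r -psi1 -mulrA mulr_suml; apply: ler_sum => q _.
rewrite mulrC -mulrA; have [->|psi0] := eqVneq (psi q) 0; first by rewrite !mul0r.
have [->|chi0] := eqVneq (chi p) 0; first by rewrite !mul0r !mulr0.
rewrite !ler_wpM2l// (le_trans (ler_distD (g p q0) _ _))// /window_var.
apply: lerD; first exact/telescope_le/psi_supp.
exact/(@telescope_le (g ^~ q0))/chi_supp.
Qed.

Lemma sum_prod_weights c : \sum_(q < Q) \sum_(p < P) c * (psi q * chi p) = c.
Proof.
under eq_bigr do rewrite -mulr_sumr -mulr_sumr chi1 mulr1.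
by rewrite -mulr_sumr psi1 mulr1.
Qed.

Lemma le_avg k : `|k - g p0 q0| <=
  \sum_(q < Q) \sum_(p < P) `|k - g p q| * (psi q * chi p) + window_avg q0.
Proof.
rewrite -(sum_prod_weights `|k - g p0 q0|) (le_trans _ (lerD (lexx _) avg_window_var))//.
rewrite -big_split/=; apply: ler_sum => q _.
rewrite -big_split/=; apply: ler_sum => p _.
by rewrite -mulrDl ler_wpM2r ?mulr_ge0// ler_distD.
Qed.

Lemma avg_le k : \sum_(q < Q) \sum_(p < P) `|k - g p q| * (psi q * chi p) <=
  `|k - g p0 q0| + window_avg q0.
Proof.
rewrite -(sum_prod_weights `|k - g p0 q0|) (le_trans _ (lerD (lexx _) avg_window_var))//.
rewrite -big_split/=; apply: ler_sum => q _.
rewrite -big_split/=; apply: ler_sum => p _.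
by rewrite -mulrDl ler_wpM2r ?mulr_ge0// [`|g p q - _|]distrC ler_distD.
Qed.

End pointwise.

(** Each increment is counted by at most [K] windows. *)
Lemma sum_window_avg (V V' : R) I :
  (forall p n, \sum_(q < n) `|g p q.+1 - g p q| <= V) ->
  (forall p n, \sum_(q < n) `|g p.+1 q - g p q| <= V') ->
  \sum_(q < I) window_avg q <= V *+ K + V' *+ K'.
Proof.
move=> gV gV'; rewrite /window_avg exchange_big/=.
rewrite -[leRHS]mul1r -chi1 mulr_suml; apply: ler_sum => p _.
rewrite -mulr_sumr ler_wpM2l// /window_var big_split/=; apply: lerD.
  rewrite exchange_big/= -[X in _ *+ X](card_ord K) -sumr_const ler_sum// => k _.
  rewrite (le_trans _ (gV p (k + I)%N))// big_split_ord/=.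
  rewrite (eq_bigr (fun i : 'I_I => `|g p (k + i).+1 - g p (k + i)%N|)).
    by rewrite lerDr sumr_ge0.
  by move=> i _; rewrite addnC.
rewrite exchange_big/= -[X in _ *+ X](card_ord K') -sumr_const ler_sum// => k _.
exact: gV'.
Qed.

End local_average.

(** * Summation by parts *)

Section entropy_production.
Context {R : realFieldType}.

Lemma summation_by_parts (h W : nat -> R) n : W 0%N = 0 -> W n.+1 = 0 ->
  \sum_(i < n.+1) h i * (W i - W i.+1) = \sum_(i < n) (h i.+1 - h i) * W i.+1.
Proof.
move=> W0 Wn.
suff : forall m, \sum_(i < m.+1) h i * (W i - W i.+1) =
    \sum_(i < m) (h i.+1 - h i) * W i.+1 - h m * W m.+1.
  by move=> ->; rewrite Wn mulr0 subr0.
elim=> [|m IH]; first by rewrite big_ord_recr !big_ord0/= W0; ring.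
by rewrite big_ord_recr/= IH [in RHS]big_ord_recr/=; ring.
Qed.

Variables (f : R -> R) (lam dx dt : R).
Hypotheses (lam_gt0 : 0 < lam) (dx_gt0 : 0 < dx) (dtE : dt = lam * dx).
Variable w : nat -> nat -> R.
Hypothesis kruzkov : forall k n j,
  `|w n.+1 j.+1 - k| <=
  `|w n j.+1 - k| - lam * (`|f (w n j.+1) - f k| - `|f (w n j) - f k|).
Hypothesis increment : forall n j,
  `|w n.+1 j.+1 - w n j.+1| = lam * `|f (w n j.+1) - f (w n j)|.

Variables (psi Z chi W r s : nat -> R) (J P : nat).
Hypotheses (psi_ge0 : forall j, 0 <= psi j) (Z_ge0 : forall j, 0 <= Z j)
  (W_ge0 : forall n, 0 <= W n).
Hypotheses (Z0 : Z 0%N = 0) (ZJ : Z J.+1 = 0) (W0 : W 0%N = 0)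
  (WP : W P.+1 = 0) (chiP : chi P = 0).
Hypotheses (psiZ : forall j, `|psi j.+1 - dx * Z j.+1| <= r j.+1)
  (chiW : forall n, `|chi n - dt * W n.+1| <= s n).

Let c n j := `|w n.+1 j - w n j|.

(** Here [psi], [chi] are the weights of the cells at a point and [Z], [W] the
values of the kernel, whose differences are the
derivatives of [psi], [chi]; [k] is the value of [u] there. If
[psi j] were [dx * Z j] and [chi n] were [dt * W n.+1], summation by parts would
turn the left side into a combination, with nonnegative weights, of the
quantities that [kruzkov] makes nonpositive. The right side is the error of
these two replacements, and the column [j = 0], where there is no discrete
entropy inequality. *)
Lemma discrete_entropy_production k :
  \sum_(j < J.+1) \sum_(n < P.+1)
    (`|k - w n j| * (psi j * (W n - W n.+1)) +
     `|f k - f (w n j)| * ((Z j - Z j.+1) * chi n)) <=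
  \sum_(n < P) c n 0 * (psi 0%N * W n.+1) +
  \sum_(j < J) \sum_(n < P)
     c n j.+1 * (r j.+1 * W n.+1 + lam^-1 * (Z j.+1 * s n)).
Proof.
pose eta n j := `|w n j - k|; pose q n j := `|f (w n j) - f k|.
under eq_bigr do rewrite big_split/=.
rewrite big_split/=.
have -> : \sum_(j < J.+1) \sum_(n < P.+1)
    `|k - w n j| * (psi j * (W n - W n.+1)) =
    \sum_(n < P) (eta n.+1 0%N - eta n 0%N) * (psi 0%N * W n.+1) +
    \sum_(j < J) \sum_(n < P) (eta n.+1 j.+1 - eta n j.+1) * (psi j.+1 * W n.+1).
  rewrite -(big_ord_recl J (fun j : 'I_J.+1 => \sum_(n < P)
     (eta n.+1 j - eta n j) * (psi j * W n.+1))).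
  apply: eq_bigr => j _.
  under eq_bigr do rewrite mulrCA distrC.
  rewrite -mulr_sumr (summation_by_parts (fun n => eta n j))// mulr_sumr.
  by apply: eq_bigr => n _; rewrite mulrCA.
have -> : \sum_(j < J.+1) \sum_(n < P.+1)
    `|f k - f (w n j)| * ((Z j - Z j.+1) * chi n) =
    \sum_(j < J) \sum_(n < P) (q n j.+1 - q n j) * (Z j.+1 * chi n).
  rewrite exchange_big/= [RHS]exchange_big/= big_ord_recr/= chiP.
  rewrite [X in _ + X]big1 ?addr0; last by move=> j _; rewrite !mulr0.
  apply: eq_bigr => n _.
  under eq_bigr do rewrite mulrA distrC.
  rewrite -mulr_suml (summation_by_parts (fun j => q n j))// mulr_suml.
  by apply: eq_bigr => j _; rewrite mulrA.
rewrite -addrA; apply: lerD.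
  apply: ler_sum => n _; rewrite ler_wpM2r ?mulr_ge0//.
  rewrite (le_trans (ler_norm _))// (le_trans (ler_dist_dist _ _))//.
  by rewrite opprB addrA subrK.
rewrite -big_split/=; apply: ler_sum => j _.
rewrite -big_split/=; apply: ler_sum => n _.
have eta_le : eta n.+1 j.+1 - eta n j.+1 <= - lam * (q n j.+1 - q n j).
  by rewrite /eta /q; have := kruzkov k n j; lra.
have deta : `|eta n.+1 j.+1 - eta n j.+1| <= c n j.+1.
  by rewrite (le_trans (ler_dist_dist _ _))// opprB addrA subrK.
have dq : `|q n j.+1 - q n j| <= lam^-1 * c n j.+1.
  rewrite /c increment mulKf ?gt_eqF//.
  by rewrite (le_trans (ler_dist_dist _ _))// opprB addrA subrK.
set de := eta _ _ - _ in eta_le deta *; set dq' := q _ _ - _ in eta_le dq *.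
(* The first summand is the discrete entropy production, the two others are
   the errors of replacing the weights by the kernel. *)
have -> : de * (psi j.+1 * W n.+1) + dq' * (Z j.+1 * chi n) =
  (de + lam * dq') * (dx * (Z j.+1 * W n.+1)) +
  (de * (psi j.+1 - dx * Z j.+1) * W n.+1 +
   dq' * (chi n - dt * W n.+1) * Z j.+1) by rewrite dtE; ring.
rewrite -[leRHS]add0r lerD//.
  by rewrite mulr_le0_ge0 ?mulr_ge0 ?(ltW dx_gt0)//; move: eta_le; lra.
have -> : c n j.+1 * (r j.+1 * W n.+1 + lam^-1 * (Z j.+1 * s n)) =
    c n j.+1 * r j.+1 * W n.+1 + lam^-1 * c n j.+1 * s n * Z j.+1 by ring.
apply: lerD; rewrite ler_wpM2r// (le_trans (ler_norm _))// normrM.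
  by rewrite ler_pM.
by rewrite ler_pM.
Qed.

End entropy_production.

(** * A smooth step function *)

Section smooth.
Context {R : realType}.
Implicit Types (f g : R -> R).

Fixpoint Ck k f : Prop :=
  if k is k'.+1 then (forall x : R, derivable f x 1) /\ Ck k' (derive1 f)
  else continuous f.

Lemma derivable_continuous f : (forall x : R, derivable f x 1) -> continuous f.
Proof. by move=> df x; apply/differentiable_continuous/derivable1_diffP. Qed.

Lemma Ck_continuous k f : Ck k f -> continuous f.
Proof. by case: k => //= k [df _]; exact: derivable_continuous. Qed.

Lemma CkW k f : Ck k.+1 f -> Ck k f.
Proof.
elim: k f => [f [df _]|k IH f]; first exact: derivable_continuous.
by move=> [df Cdf]; split => //; exact: IH.
Qed.

Lemma is_derive_derive1 f (df : R -> R) :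
  (forall x : R, is_derive x 1 f (df x)) -> (derive1 f) = df.
Proof. by move=> fdf; apply/funext => x; rewrite derive1E; case: (fdf x). Qed.

Lemma is_derive1P f (x : R) : derivable f x 1 -> is_derive x 1 f ((derive1 f) x).
Proof. by move=> df; rewrite derive1E; exact: derivableP. Qed.

Lemma is_derive_cstB (c : R) f (x df : R) :
  is_derive x 1 f df -> is_derive x 1 (fun y => c - f y) (- df).
Proof.
by move=> fdf; have := is_deriveB (is_derive_cst c x (1 : R)) fdf; rewrite sub0r.
Qed.

Lemma Ck_is_derive k f (df : R -> R) :
  (forall x : R, is_derive x 1 f (df x)) -> Ck k df -> Ck k.+1 f.
Proof.
move=> fdf Cdf; split; last by rewrite (is_derive_derive1 fdf).
by move=> x; case: (fdf x).
Qed.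

Lemma Ck_cst k (c : R) : Ck k (cst c).
Proof.
elim: k c => [|k IH] c; first exact: cst_continuous.
by apply: (@Ck_is_derive _ _ (cst 0)).
Qed.

Lemma Ck_id k : Ck k (@idfun R).
Proof.
case: k => [|k]; first by move=> x; exact: cvg_id.
by apply: (@Ck_is_derive _ _ (cst 1)); exact: Ck_cst.
Qed.

Lemma CkD k f g : Ck k f -> Ck k g -> Ck k (f \+ g).
Proof.
elim: k f g => [|k IH] f g; first by move=> cf cg x; exact: cvgD (cf x) (cg x).
move=> [df Cf] [dg Cg]; apply: (@Ck_is_derive _ _ ((derive1 f) \+ (derive1 g))); last exact: IH.
by move=> x; apply: is_deriveD; exact: is_derive1P.
Qed.

Lemma CkM k f g : Ck k f -> Ck k g -> Ck k (f \* g).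
Proof.
elim: k f g => [|k IH] f g; first by move=> cf cg x; exact: cvgM (cf x) (cg x).
move=> Cf Cg; have [df Cf'] := Cf; have [dg Cg'] := Cg.
apply: (@Ck_is_derive _ _ ((f \* (derive1 g)) \+ (g \* (derive1 f)))).
  by move=> x; apply: is_deriveM; exact: is_derive1P.
by apply: CkD; apply: IH => //; exact: CkW.
Qed.

Lemma Ck_comp k f g : Ck k f -> Ck k g -> Ck k (f \o g).
Proof.
elim: k f g => [|k IH] f g.
  by move=> cf cg x; apply: continuous_comp; [exact: cg|exact: cf].
move=> Cf Cg; have [df Cf'] := Cf; have [dg Cg'] := Cg.
apply: (@Ck_is_derive _ _ (((derive1 f) \o g) \* (derive1 g))).
  by move=> x; apply: is_derive1_comp; exact: is_derive1P.
by apply: CkM => //; apply: IH => //; exact: CkW.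
Qed.

Lemma lipschitz_of_derive f (df : R -> R) B :
  (forall x : R, is_derive x 1 f (df x)) -> (forall x, `|df x| <= B) ->
  forall x y, `|f y - f x| <= B * `|y - x|.
Proof.
move=> fdf dfB x y.
have cf : continuous f by apply: derivable_continuous => z; case: (fdf z).
wlog xy : x y / x <= y.
  by move=> H; have [/H//|/ltW/H] := leP x y; rewrite distrC [`|x - y|]distrC.
have [c _ ->] := MVT_segment xy (fun z _ => fdf z) (continuous_subspaceT cf).
by rewrite normrM ler_wpM2r.
Qed.

(** The functions [x |-> P(1/x) exp(-1/x)], extended by 0, are closed under
differentiation; this gives the smoothness of [exp(-1/x)] at 0. *)
Definition flat (P : {poly R}) (x : R) : R :=
  if 0 < x then P.[x^-1] * expR (- x^-1) else 0.

(** From [y ^ i <= i ^ i * exp y], which is [y / i <= exp (y / i)] raised to the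
power [i]. *)
Lemma horner_le_expR (P : {poly R}) :
  exists2 C, 0 <= C & forall y, 0 <= y -> `|P.[y]| <= C * expR y.
Proof.
exists (\sum_(i < size P) `|P`_i| * i%:R ^+ i).
  by apply: sumr_ge0 => i _; rewrite mulr_ge0// exprn_ge0.
move=> y y0; rewrite horner_coef mulr_suml (le_trans (ler_norm_sum _ _ _))//.
apply: ler_sum => i _; rewrite normrM -mulrA ler_wpM2l// ger0_norm ?exprn_ge0//.
have [->|i0] := eqVneq (i : nat) 0%N; first by rewrite !expr0 mul1r -expR0 ler_expR.
have i0' : 0 < (i : nat)%:R :> R by rewrite ltr0n lt0n.
have {2}-> : y = y / i%:R * i%:R by rewrite divfK// gt_eqF.
have -> : y ^+ i = (y / i%:R) ^+ i * i%:R ^+ i by rewrite -exprMn divfK// gt_eqF.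
rewrite mulrC ler_wpM2l ?exprn_ge0// expRM_natr lerXn2r ?nnegrE ?divr_ge0 ?expR_ge0//.
by rewrite (le_trans _ (expR_ge1Dx _))// lerDr.
Qed.

(** Apply the growth bound to [P * 'X] at [1 / x]. The same bound for
[P * 'X] in place of [P] says that the difference quotient of [flat P] at 0
tends to 0. *)
Lemma flat_le (P : {poly R}) : exists2 C, 0 <= C & forall x, `|flat P x| <= C * `|x|.
Proof.
have [C C0 PC] := horner_le_expR (P * 'X).
exists C => // x; rewrite /flat; case: ifPn => [x0|_]; last by rewrite normr0 mulr_ge0.
have := PC x^-1; rewrite invr_ge0 (ltW x0) => /(_ isT).
rewrite hornerM hornerX !normrM (gtr0_norm (expR_gt0 _)) expRN.
rewrite (gtr0_norm x0) (@gtr0_norm _ x^-1) ?invr_gt0// ler_pdivrMr// => H.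
by rewrite ler_pdivrMr ?expR_gt0// mulrAC.
Qed.

Lemma is_derive_flat (P : {poly R}) (x : R) :
  is_derive x 1 (flat P) (flat ('X^2 * (P - deriv P)) x).
Proof.
have [x0|x0|->] := ltgtP x 0.
- rewrite [X in is_derive _ _ _ X](_ : _ = 0); last first.
    by rewrite /flat ltNge (ltW x0).
  apply: (@near_eq_is_derive _ _ _ (cst 0)) (is_derive_cst 0 x 1).
  near=> y; rewrite /flat ltNge (_ : y <= 0)// ltW//.
  by near: y; exact: lt_nbhsl.
- have flatE : \near x,
      ((horner P \o (fun y => y^-1)) \* (expR \o (fun y => - y^-1))) x = flat P x.
    near=> y; rewrite /flat (_ : 0 < y)//.
    by near: y; exact: lt_nbhsr.
  apply: (near_eq_is_derive flatE).
  have xn0 : x != 0 by rewrite gt_eqF.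
  have di : is_derive x 1 (fun y : R => y^-1) (- x ^- 2).
    by have := is_deriveV xn0 (is_derive_id x 1); rewrite [_ *: 1]mulr1.
  have d1 := is_derive1_comp (is_derive_poly P x^-1) di.
  have d2 := @is_derive1_comp _ expR (fun y : R => - y^-1) x _ _
    (is_derive_expR (- x^-1)) (is_deriveN di).
  apply: is_derive_eq (is_deriveM d1 d2) _.
  rewrite /flat x0 /= !hornerE /GRing.scale/=.
  by field.
- rewrite [X in is_derive _ _ _ X](_ : _ = 0); last by rewrite /flat ltxx.
  have [C C0 HC] := flat_le (P * 'X).
  suff : (fun h : R => h^-1 *: (flat P (h *: 1 + 0) - flat P 0)) @ 0^' --> (0 : R).
    by move=> h; apply: DeriveDef; [apply/cvg_ex; exists 0|exact/cvg_lim].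
  have C1 : 0 < C + 1 by rewrite ltr_wpDl.
  apply/cvgr0Pnorm_le => e e0; near=> h.
  have hn0 : h != 0 by near: h; exact: nbhs_dnbhs_neq.
  have -> : h^-1 *: (flat P (h *: 1 + 0) - flat P 0) = flat (P * 'X) h.
    rewrite addr0 [h *: 1]mulr1 /flat ltxx subr0; case: ifPn => _.
      by rewrite hornerM hornerX -[LHS]/(_ * _) mulrC mulrAC.
    exact: scaler0.
  rewrite (le_trans (HC h))//.
  apply: (@le_trans _ _ ((C + 1) * `|h|)); first by rewrite ler_wpM2r ?lerDl.
  rewrite mulrC -ler_pdivlMr//.
  by near: h; apply: dnbhs0_le; rewrite divr_gt0.
Unshelve. all: by end_near. Qed.

Lemma Ck_flat k P : Ck k (flat P).
Proof.
elim: k P => [|k IH] P.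
  by apply: derivable_continuous => x; case: (is_derive_flat P x).
by apply: Ck_is_derive (IH _) => x; exact: is_derive_flat.
Qed.

Let p := flat 1.

Let pE x : 0 < x -> p x = expR (- x^-1).
Proof. by move=> x0; rewrite /p /flat x0 hornerC mul1r. Qed.

Let p0 x : x <= 0 -> p x = 0.
Proof. by move=> x0; rewrite /p /flat ltNge x0. Qed.

Let p' := flat 'X^2.

Let dp (x : R) : is_derive x 1 p (p' x).
Proof.
by have := is_derive_flat 1 x; rewrite derivC subr0 mulr1.
Qed.

Let p'_ge0 x : 0 <= p' x.
Proof.
rewrite /p' /flat; case: ifPn => // x0.
by rewrite hornerXn mulr_ge0 ?expR_ge0// exprn_ge0// invr_ge0 ltW.
Qed.

Let p1_gt0 : 0 < p (p 1).
Proof. by rewrite pE ?expR_gt0// pE// expR_gt0. Qed.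

Lemma ge0_derive_le f (df : R -> R) : (forall x : R, is_derive x 1 f (df x)) ->
  (forall x, 0 <= df x) -> {homo f : x y / x <= y}.
Proof.
move=> fdf df0 x y xy.
have cf : continuous f by apply: derivable_continuous => z; case: (fdf z).
have [c _ e] := MVT_segment xy (fun z _ => fdf z) (continuous_subspaceT cf).
by rewrite -subr_ge0 e mulr_ge0// subr_ge0.
Qed.

(** [th] is the step and [om] its derivative, the kernel. With
[p x = exp(-1/x)] for [x > 0] and 0 elsewhere, the step is
[p (p 1 - p (1 - x)) / p (p 1)]: for [x <= 0] the inner argument is nonpositive,
for [x >= 1] it is [p 1]. *)
Lemma smooth_step : exists th om : R -> R, exists B : R,
  [/\ forall k, Ck k th, forall x : R, is_derive x 1 th (om x),
      {homo th : x y / x <= y}, forall x, x <= 0 -> th x = 0 &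
      forall x, 1 <= x -> th x = 1] /\
  [/\ 0 <= B, forall x, 0 <= om x <= B, forall x, x < 0 -> om x = 0,
      forall x, 1 < x -> om x = 0 & forall x y, `|om y - om x| <= B * `|y - x|].
Proof.
pose th x := (p (p 1))^-1 * p (p 1 - p (1 - x)).
have Cp k : Ck k p by exact: Ck_flat.
have p_mono : {homo p : x y / x <= y} by exact: ge0_derive_le dp p'_ge0.
have Cth k : Ck k th.
  have COn : Ck k (cst 1 \+ (cst (-1) \* idfun)).
    by apply: CkD; [exact: Ck_cst|apply: CkM; [exact: Ck_cst|exact: Ck_id]].
  have Ci : Ck k (cst (p 1) \+ (cst (-1) \* (p \o (cst 1 \+ (cst (-1) \* idfun))))).
    apply: CkD; first exact: Ck_cst.
    by apply: CkM; [exact: Ck_cst|exact: Ck_comp].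
  rewrite (_ : th = cst (p (p 1))^-1 \* (p \o
     (cst (p 1) \+ (cst (-1) \* (p \o (cst 1 \+ (cst (-1) \* idfun))))))); last first.
    by apply/funext => x; rewrite /th/= !mulN1r.
  by apply: CkM; [exact: Ck_cst|exact: Ck_comp].
pose om := derive1 th; pose om' := derive1 om.
have dth (x : R) : is_derive x 1 th (om x) by apply: is_derive1P; case: (Cth 1%N).
have dom (x : R) : is_derive x 1 om (om' x).
  by apply: is_derive1P; case: (Cth 2) => _ [].
have c_om' : continuous om' by case: (Cth 2) => _ [].
have th_mono : {homo th : x y / x <= y}.
  move=> x y xy; rewrite /th ler_wpM2l ?invr_ge0 ?(ltW p1_gt0)//.
  by rewrite p_mono// lerB// p_mono// lerB.
have th0 x : x <= 0 -> th x = 0.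
  move=> x0; rewrite /th (p0 (_ : p 1 - p (1 - x) <= 0)) ?mulr0// subr_le0 p_mono//.
  by rewrite lerDl oppr_ge0.
have th1 x : 1 <= x -> th x = 1.
  move=> x1; rewrite /th (p0 (_ : 1 - x <= 0)) ?subr_le0// subr0 mulVf//.
  by rewrite gt_eqF.
have om_ge0 x : 0 <= om x.
  suff -> : om = fun x => (p (p 1))^-1 * (p' (p 1 - p (1 - x)) * p' (1 - x)).
    by rewrite !mulr_ge0 ?invr_ge0 ?(ltW p1_gt0).
  apply: is_derive_derive1 => {}x.
  have d2 := @is_derive1_comp _ p (fun y => 1 - y) x _ _ 
    (dp (1 - x)) (is_derive_cstB 1 (is_derive_id x 1)).
  have d3 : is_derive x 1 (fun y => p 1 - p (1 - y)) (p' (1 - x)).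
    by have := is_derive_cstB (p 1) d2; rewrite mulrN1 opprK.
  have d4 := @is_derive1_comp _ p (fun y => p 1 - p (1 - y)) x _ _
    (dp (p 1 - p (1 - x))) d3.
  exact: (is_deriveZ (p (p 1))^-1 d4).
have const0 (g : R -> R) c x : (\near x, g x = c) -> derive1 g x = 0.
  move=> gc; rewrite derive1E; have [] // := @near_eq_is_derive _ _ _ (cst c) g x 1 0.
  by near=> y; apply/esym; near: y.
have om_lt0 x : x < 0 -> om x = 0.
  move=> x0; apply: (const0 _ 0); near=> y; apply/th0/ltW.
  by near: y; exact: lt_nbhsl.
have om_gt1 x : 1 < x -> om x = 0.
  move=> x0; apply: (const0 _ 1); near=> y; apply/th1/ltW.
  by near: y; exact: lt_nbhsr.
have om'_lt0 x : x < 0 -> om' x = 0.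
  move=> x0; apply: (const0 _ 0); near=> y; apply: om_lt0.
  by near: y; exact: lt_nbhsl.
have om'_gt1 x : 1 < x -> om' x = 0.
  move=> x0; apply: (const0 _ 0); near=> y; apply: om_gt1.
  by near: y; exact: lt_nbhsr.
have [B [B0 om'B]] : exists B, 0 <= B /\ forall x, `|om' x| <= B.
  have cn : {within `[0, 1], continuous (fun x => `|om' x|)}.
    apply: continuous_subspaceT => x.
    exact: (continuous_comp (c_om' x) (@norm_continuous _ _ _)).
  have [c _ cmax] := EVT_max ler01 cn.
  exists `|om' c|; split; first exact: normr_ge0.
  move=> x.
  have [x0|x0] := ltP x 0; first by rewrite om'_lt0// normr0 normr_ge0.
  have [x1|x1] := ltP 1 x; first by rewrite om'_gt1// normr0 normr_ge0.
  by apply: cmax; rewrite in_itv/= x0.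
have om_lip x y : `|om y - om x| <= B * `|y - x| by exact: lipschitz_of_derive om'B x y.
exists th, om, (B *+ 2); split; split => //.
- by rewrite mulrn_wge0.
- move=> x; rewrite om_ge0/=.
  have [x0|x0] := ltP x 0; first by rewrite om_lt0// mulrn_wge0.
  have [x1|x1] := ltP 1 x; first by rewrite om_gt1// mulrn_wge0.
  have := om_lip (-1) x; rewrite (om_lt0 (-1))// subr0 ger0_norm//.
  move=> /le_trans; apply; rewrite -mulr_natr ler_wpM2l// opprK.
  by rewrite ger0_norm; lra.
- move=> x y; rewrite (le_trans (om_lip x y))// ler_wpM2r// mulr2n lerDl//.
Unshelve. all: by end_near. Qed.

End smooth.

(** * Test functions *)

Section test_functions.
Context {R : realType}.
Implicit Types (g h : R -> R).

Definition tensor g h (z : R * R) : R := g z.1 * h z.2.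

Lemma is_derive_tensor1 g h (z : R * R) : derivable g z.1 1 ->
  is_derive z (1, 0) (tensor g h) (tensor (derive1 g) h z).
Proof.
move=> dg.
have cg : (fun k : R => k^-1 *: (tensor g h (k *: (1, 0) + z) - tensor g h z)) @ 0^'
    --> tensor (derive1 g) h z.
  rewrite [X in X @ _ --> _](_ : _ =
      (fun k : R => (k^-1 *: (g (k *: 1 + z.1) - g z.1)) * h z.2)); last first.
    apply/funext => k; rewrite /tensor/= [k *: 0]mulr0 add0r -mulrBl.
    by rewrite [LHS]mulrA.
  apply: cvgMl; rewrite derive1E; exact: dg.
by apply: DeriveDef; [apply/cvg_ex; eexists; exact: cg|exact/cvg_lim].
Qed.

Lemma is_derive_tensor2 g h (z : R * R) : derivable h z.2 1 ->
  is_derive z (0, 1) (tensor g h) (tensor g (derive1 h) z).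
Proof.
move=> dh.
have ch : (fun k : R => k^-1 *: (tensor g h (k *: (0, 1) + z) - tensor g h z)) @ 0^'
    --> tensor g (derive1 h) z.
  rewrite [X in X @ _ --> _](_ : _ =
      (fun k : R => g z.1 * (k^-1 *: (h (k *: 1 + z.2) - h z.2)))); last first.
    apply/funext => k; rewrite /tensor/= [k *: 0]mulr0 add0r -mulrBr.
    by rewrite [LHS]mulrCA.
  apply: cvgMr; rewrite derive1E; exact: dh.
by apply: DeriveDef; [apply/cvg_ex; eexists; exact: ch|exact/cvg_lim].
Qed.

Lemma continuous_tensor g h : continuous g -> continuous h ->
  continuous (tensor g h).
Proof.
move=> cg ch z; apply: cvgM.
  by apply: (continuous_comp (f := fst)); [exact: cvg_fst|exact: cg].
by apply: (continuous_comp (f := snd)); [exact: cvg_snd|exact: ch].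
Qed.

Lemma Ck2_tensor k g h : Ck k g -> Ck k h -> Ck2 k (tensor g h).
Proof.
elim: k g h => [|k IH] g h; first exact: continuous_tensor.
move=> Cg Ch; have [dg Cg'] := Cg; have [dh Ch'] := Ch.
have d1 z := is_derive_tensor1 h (dg z.1).
have d2 z := is_derive_tensor2 g (dh z.2).
have e1 : 'D_(1, 0) (tensor g h) = tensor (derive1 g) h.
  by apply/funext => z; case: (d1 z).
have e2 : 'D_(0, 1) (tensor g h) = tensor g (derive1 h).
  by apply/funext => z; case: (d2 z).
split.
- by apply: continuous_tensor; [exact: Ck_continuous Cg|exact: Ck_continuous Ch].
- by move=> z; case: (d1 z).
- by move=> z; case: (d2 z).
- by rewrite e1; apply: IH => //; exact: CkW.
- by rewrite e2; apply: IH => //; exact: CkW.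
Qed.

Variables (th om : R -> R) (eps : R).
Hypotheses (Cth : forall k, Ck k th) (dth : forall x : R, is_derive x 1 th (om x)).

(** The integral over the cell from [p] to [q] of the kernel
[y |-> om ((y - x) / eps) / eps], which lives between [x] and [x + eps]. *)
Definition cell_weight (p q x : R) : R := th ((q - x) / eps) - th ((p - x) / eps).

Definition mollifier (p x : R) : R := om ((p - x) / eps) / eps.

Let shift (p x : R) : R := (p - x) / eps.

Lemma is_derive_th_shift (p x : R) :
  is_derive x 1 (fun y => th ((p - y) / eps)) (- mollifier p x).
Proof.
have d1 : is_derive x 1 (shift p) (- eps^-1).
  have := is_deriveZ eps^-1 (is_derive_cstB p (is_derive_id x (1 : R))).
  rewrite (_ : _ \*: _ = shift p) /GRing.scale/= ?mulrN1//.
  by apply/funext => y; rewrite /shift/= mulrC.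
have := @is_derive1_comp _ th (shift p) x _ _ (dth (shift p x)) d1.
by rewrite mulrN.
Qed.

Lemma Ck_th_shift k (p : R) : Ck k (fun y => th ((p - y) / eps)).
Proof.
rewrite (_ : (fun _ => _) = th \o ((cst p \+ (cst (-1) \* idfun)) \* cst eps^-1)).
  apply: Ck_comp => //; apply: CkM; last exact: Ck_cst.
  apply: CkD; first exact: Ck_cst.
  by apply: CkM; [exact: Ck_cst|exact: Ck_id].
by apply/funext => x/=; rewrite mulN1r.
Qed.

Lemma is_derive_cell_weight (p q x : R) :
  is_derive x 1 (cell_weight p q) (mollifier p x - mollifier q x).
Proof.
have := is_deriveB (is_derive_th_shift q x) (is_derive_th_shift p x).
by rewrite opprK [- mollifier _ _ + _]addrC.
Qed.

Lemma Ck_cell_weight k (p q : R) : Ck k (cell_weight p q).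
Proof.
rewrite (_ : cell_weight p q = (fun y => th ((q - y) / eps)) \+
    (cst (-1) \* (fun y => th ((p - y) / eps)))).
  apply: CkD; first exact: Ck_th_shift.
  by apply: CkM; [exact: Ck_cst|exact: Ck_th_shift].
by apply/funext => x/=; rewrite mulN1r.
Qed.

Hypothesis th_mono : {homo th : x y / x <= y}.
Hypothesis eps_gt0 : 0 < eps.

Lemma cell_weight_ge0 (p q x : R) : p <= q -> 0 <= cell_weight p q x.
Proof.
by move=> pq; rewrite subr_ge0 th_mono// ler_pM2r ?invr_gt0// lerB.
Qed.

Lemma test_cell_weight L T (p q p' q' : R) : p <= q -> p' <= q' ->
  nonneg_test L T (tensor (cell_weight p q) (cell_weight p' q')).
Proof.
move=> pq pq'; split; first by move=> k; apply: Ck2_tensor; exact: Ck_cell_weight.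
by move=> x t _ _; rewrite mulr_ge0// cell_weight_ge0.
Qed.

Lemma derive_cell_weight1 (p q p' q' x t : R) :
  'D_(1, 0) (tensor (cell_weight p q) (cell_weight p' q')) (x, t) =
  (mollifier p x - mollifier q x) * cell_weight p' q' t.
Proof.
have [d e] := is_derive_cell_weight p q x.
by have [_ ->] := is_derive_tensor1 (z := (x, t)) (cell_weight p' q') d;
  rewrite /tensor/= derive1E e.
Qed.

Lemma derive_cell_weight2 (p q p' q' x t : R) :
  'D_(0, 1) (tensor (cell_weight p q) (cell_weight p' q')) (x, t) =
  cell_weight p q x * (mollifier p' t - mollifier q' t).
Proof.
have [d e] := is_derive_cell_weight p' q' t.
by have [_ ->] := is_derive_tensor2 (z := (x, t)) (cell_weight p q) d;
  rewrite /tensor/= derive1E e.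
Qed.

Lemma continuous_cell_weight (p q : R) : continuous (cell_weight p q).
Proof. exact: (Ck_cell_weight 0). Qed.

Lemma continuous_mollifier (p : R) : continuous om -> continuous (mollifier p).
Proof.
move=> com x; apply: cvgMl; apply: (@continuous_comp _ _ _ (shift p) om); last exact: com.
by apply: cvgMl; apply: cvgB; [exact: cvg_cst|exact: cvg_id].
Qed.

End test_functions.

(** * Integrals *)

Section integrals.
Context d (T : measurableType d) (R : realType).
Variable mu : {measure set T -> \bar R}.
Implicit Types (D : set T) (f g : T -> R).

Lemma ae_imply (P Q : T -> Prop) : (forall x, P x -> Q x) ->
  {ae mu, forall x, P x} -> {ae mu, forall x, Q x}.
Proof. by move=> PQ; exact: filterS. Qed.

Lemma ae_imply2 (P P' Q : T -> Prop) : (forall x, P x -> P' x -> Q x) ->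
  {ae mu, forall x, P x} -> {ae mu, forall x, P' x} -> {ae mu, forall x, Q x}.
Proof. by move=> PQ; exact: filterS2. Qed.

Lemma ae_le_Rintegral D f g : measurable D ->
  mu.-integrable D (EFin \o f) -> mu.-integrable D (EFin \o g) ->
  {ae mu, forall x, D x -> f x <= g x} ->
  \int[mu]_(x in D) f x <= \int[mu]_(x in D) g x.
Proof.
move=> mD fi gi [N [mN N0 fgN]].
have E h : mu.-integrable D (EFin \o h) ->
    \int[mu]_(x in D) h x = \int[mu]_(x in D `\` N) h x.
  by move=> hi; rewrite /Rintegral (@negligible_integral _ _ _ mu D N).
rewrite !E//; apply: le_Rintegral; [exact: measurableD| | |].
- by apply: integrableS fi => //; exact: measurableD.
- by apply: integrableS gi => //; exact: measurableD.
- move=> x [Dx Nx]; apply: contrapT => fg; apply: Nx; apply: fgN => /= H.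
  exact/fg/H.
Qed.

Lemma Rintegral_sum D (I : Type) (s : seq I) (F : I -> T -> R) : measurable D ->
  (forall i, mu.-integrable D (EFin \o F i)) ->
  mu.-integrable D (EFin \o (fun x => \sum_(i <- s) F i x)) /\
  \int[mu]_(x in D) (\sum_(i <- s) F i x) = \sum_(i <- s) \int[mu]_(x in D) F i x.
Proof.
move=> mD Fi; elim: s => [|i s [IHi IH]].
  rewrite big_nil; split.
    rewrite (_ : _ \o _ = cst 0%E); first exact: integrable0.
    by apply/funext => x /=; rewrite big_nil.
  rewrite (@eq_Rintegral _ _ _ _ _ (cst 0)); last by move=> x _; rewrite big_nil.
  by rewrite Rintegral_cst// mul0r.
have E : (fun x => \sum_(j <- i :: s) F j x) =
    (fun x => F i x + \sum_(j <- s) F j x).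
  by apply/funext => x; rewrite big_cons.
rewrite {}E big_cons -IH RintegralD//; split => //.
exact: integrableD (Fi i) IHi.
Qed.

Lemma ae_bounded_integrable D f (K : R) : measurable D -> (mu D < +oo)%E ->
  measurable_fun D f -> {ae mu, forall x, D x -> `|f x| <= K} ->
  mu.-integrable D (EFin \o f).
Proof.
move=> mD Dfin mf fK; apply/integrableP; split; first exact/measurable_EFinP.
apply: (@le_lt_trans _ _ (\int[mu]_(x in D) (cst (`|K|%:E) x))%E).
  apply: ae_ge0_le_integral => //.
  - by apply: measurableT_comp => //; exact/measurable_EFinP.
  - by move=> x _ /=; rewrite lee_fin.
  - apply: filterS fK => x H Dx /=.
    by rewrite lee_fin (le_trans (H Dx))// ler_norm.
by rewrite integral_cst// lte_mul_pinfty.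
Qed.

Lemma integrable_weighted D f (wt : T -> R) (c : R) : measurable D ->
  (mu D < +oo)%E -> mu.-integrable D (EFin \o f) ->
  measurable_fun D wt -> (forall x, `|wt x| <= 1) ->
  mu.-integrable D (EFin \o (fun x => `|f x - c| * wt x)).
Proof.
move=> mD Dfin fi mwt wt1.
have ci : mu.-integrable D (EFin \o (cst c)).
  apply: (ae_bounded_integrable (K := `|c|)) => //.
  by apply: filterE.
have fci : mu.-integrable D (EFin \o (fun x => `|f x - c|)).
  exact: (integrable_norm (integrableB mD fi ci)).
apply: le_integrable fci => //.
  apply/measurable_EFinP/measurable_funM => //.
  apply: measurableT_comp => //; apply: measurable_funB => //.
  exact/measurable_EFinP/(measurable_int _ fi).
move=> x Dx /=; rewrite lee_fin normrM !normr_id ler_piMr//.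
Qed.

Lemma integrable_fin D f : mu.-integrable D (EFin \o f) -> measurable D ->
  (\int[mu]_(x in D) (f x)%:E = (\int[mu]_(x in D) f x)%:E)%E.
Proof. by move=> fi mD; rewrite /Rintegral fineK// integrable_fin_num. Qed.

End integrals.

Section fubini.
Context d1 d2 (T1 : measurableType d1) (T2 : measurableType d2) (R : realType).
Variables (m1 : {sigma_finite_measure set T1 -> \bar R})
  (m2 : {sigma_finite_measure set T2 -> \bar R}).

Lemma Rintegral_iterated (A : set T1) (B : set T2) (g : T1 * T2 -> R) :
  measurable A -> measurable B ->
  (m1 \x m2)%E.-integrable (A `*` B) (EFin \o g) ->
  \int[m2]_(y in B) \int[m1]_(x in A) g (x, y) =
  \int[(m1 \x m2)%E]_(z in A `*` B) g z.
Proof.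
move=> mA mB gi; have mAB : measurable (A `*` B) by exact: measurableX.
have gi' : (m1 \x m2)%E.-integrable setT (EFin \o (g \_ (A `*` B))).
  by rewrite -restrict_EFin; exact/(integrable_mkcond _ mAB).
rewrite [RHS]Rintegral_mkcond [RHS]/Rintegral -integral21_prod_meas1//.
set G := fubini_G _ _.
have mg' := measurable_int _ gi'.
have mG : measurable_fun setT G by apply: (measurable_fubini_G gi').
have iG : m2.-integrable setT G.
  apply/integrableP; split => //.
  apply: le_lt_trans ((integrable21ltyP m1 m2 mg').1 gi').
  apply: ge0_le_integral => //.
  - by apply: measurableT_comp.
  - apply: (@measurable_fun_fubini_tonelli_G _ _ _ _ _ m1
      (abse \o (EFin \o g \_ (A `*` B)))).
      exact: measurableT_comp.
    by move=> z; exact: abse_ge0.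
  - move=> y _; apply: le_abse_integral => //.
    exact: measurableT_comp mg' (measurable_pair2 y).
have GE : (fun y => (\int[m1]_(x in A) g (x, y))) \_ B = fine \o G.
  apply/funext => y; rewrite /G /fubini_G patchE; case: ifPn => yB.
    rewrite /Rintegral integral_mkcond/=; congr fine; apply: eq_integral => x _.
    by rewrite !patchE in_setX yB andbT; case: ifP.
  rewrite /= integral0_eq// => x _ /=.
  by rewrite patchE in_setX (negbTE yB) andbF.
have mfG : measurable_fun setT (fine \o G) by exact: measurableT_comp.
have ifG : m2.-integrable setT (EFin \o (fine \o G)).
  apply: le_integrable iG => //; first exact/measurable_EFinP.
  by move=> y _ /=; case: (G y) => [r| |] /=; rewrite ?leey.
rewrite Rintegral_mkcond GE /Rintegral; congr fine.
have [N [mN N0 GN]] := integrable_ae measurableT iG.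
rewrite [LHS](negligible_integral mN measurableT ifG N0).
rewrite [RHS](negligible_integral mN measurableT iG N0).
apply: eq_integral => y; rewrite inE => -[_ Ny] /=; rewrite fineK//.
by apply: contrapT => H; apply: Ny; apply: GN => /(_ I) /H.
Qed.

End fubini.

Section indicators.
Context d (T : measurableType d) (R : realType).
Variable mu : {measure set T -> \bar R}.

Lemma integrable_indic_fin (D E : set T) : measurable D -> measurable E ->
  (mu D < +oo)%E -> mu.-integrable D (EFin \o (\1_E : T -> R)).
Proof.
move=> mD mE Dfin; apply: (ae_bounded_integrable (K := 1)) => //.
apply: filterE => x _; rewrite indicE; case: (x \in E) => /=;
  by rewrite ?normr1 ?normr0 ?ler01.
Qed.

Lemma Rintegral_indic_le (D E : set T) (l : R) : measurable D -> measurable E ->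
  (mu E <= l%:E)%E -> \int[mu]_(x in D) (\1_E x : R) <= l.
Proof.
move=> mD mE El; have l0 : 0 <= l.
  by rewrite -lee_fin (le_trans _ El).
rewrite /Rintegral integral_indic//.
have ED : (mu (E `&` D) <= l%:E)%E.
  by rewrite (le_trans _ El)// le_measure ?inE//; exact: measurableI.
by rewrite -lee_fin fineK// ge0_fin_numE// (le_lt_trans ED)// ltry.
Qed.

End indicators.

Section lebesgue.
Context {R : realType}.
Local Notation mu := (@lebesgue_measure R).

Lemma lebesgue_oo (p q : R) : p <= q -> mu `]p, q[ = (q - p)%:E.
Proof.
move=> pq; rewrite lebesgue_measure_itv/= lte_fin.
by case: ltgtP pq => // ->; rewrite subrr.
Qed.

Lemma lebesgue_co (p q : R) : p <= q -> mu `[p, q[ = (q - p)%:E.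
Proof.
move=> pq; rewrite lebesgue_measure_itv/= lte_fin.
by case: ltgtP pq => // ->; rewrite subrr.
Qed.

Lemma lebesgue_cc (p q : R) : p <= q -> mu `[p, q] = (q - p)%:E.
Proof.
move=> pq; rewrite lebesgue_measure_itv/= lte_fin.
by case: ltgtP pq => // ->; rewrite subrr.
Qed.

Lemma lebesgue_oo_fin (p q : R) : (mu `]p, q[ < +oo)%E.
Proof. by rewrite lebesgue_measure_itv/=; case: ifP => _; rewrite ?ltry// -EFinB ltry. Qed.

Lemma lebesgue_rect (p q p' q' : R) : p <= q -> p' <= q' ->
  (mu \x mu)%E (`[p, q] `*` `[p', q']) = ((q - p) * (q' - p'))%:E.
Proof.
move=> pq pq'; transitivity (mu `[p, q] * mu `[p', q'])%E.
  exact: product_measure1E.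
by rewrite !lebesgue_cc.
Qed.

Lemma cell_index (h x : R) N : 0 < h -> 0 <= x -> x < N%:R * h ->
  exists2 i, (i < N)%N & i%:R * h <= x < i.+1%:R * h.
Proof.
move=> h0 x0 xN; exists (Num.truncn (x / h)).
  by rewrite truncn_lt_nat ?divr_ge0 ?(ltW h0)// ltr_pdivrMr.
by rewrite -ler_pdivlMr// -ltr_pdivrMr// truncn_itv ?divr_ge0// ltW.
Qed.

Lemma cell_index_unique (h x : R) i j : 0 < h ->
  i%:R * h <= x < i.+1%:R * h -> j%:R * h <= x < j.+1%:R * h -> i = j.
Proof.
move=> h0 /andP[ix xi] /andP[jx xj]; apply/eqP; rewrite eqn_leq.
by apply/andP; split; rewrite -ltnS -(ltr_nat R) -(ltr_pM2r h0);
  [exact: le_lt_trans xj|exact: le_lt_trans xi].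
Qed.

Definition step_fun (h : R) N (G : nat -> R) (x : R) : R :=
  \sum_(i < N) G i * \1_(`[i%:R * h, i.+1%:R * h[%classic) x.

Lemma step_funE (h : R) N (G : nat -> R) (x : R) i : 0 < h -> (i < N)%N ->
  i%:R * h <= x < i.+1%:R * h -> step_fun h N G x = G i.
Proof.
move=> h0 iN ix; rewrite /step_fun (bigD1 (Ordinal iN))//= big1 ?addr0.
  by rewrite indicE mem_set ?mulr1//= in_itv.
move=> j ji; rewrite indicE memNset ?mulr0//= in_itv/= => jx.
by move/eqP : ji; apply; apply/val_inj/esym/(cell_index_unique h0 ix jx).
Qed.

Lemma step_fun_integral (L h : R) N (G : nat -> R) : 0 < h ->
  mu.-integrable `]0, L[ (EFin \o step_fun h N G) /\
  ((forall i, 0 <= G i) ->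
   \int[mu]_(x in `]0, L[) step_fun h N G x <= h * \sum_(i < N) G i).
Proof.
move=> h0.
pose cell i : set R := `[i%:R * h, i.+1%:R * h[%classic.
have mcell i : measurable (cell i) by exact: measurable_itv.
pose F (i : 'I_N) x := G i * (\1_(cell i) x : R).
have indi i : mu.-integrable `]0, L[ (EFin \o (\1_(cell i) : R -> R)).
  by apply: integrable_indic_fin; [|exact: mcell|exact: lebesgue_oo_fin].
have Fi i : mu.-integrable `]0, L[ (EFin \o F i).
  exact: (integrableZl _ (G i) (indi i)).
have [Si SE] := @Rintegral_sum _ _ R mu `]0, L[%classic _ (index_enum 'I_N) F
  (measurable_itv _) Fi.
split=> [|G0]; first exact: Si.
rewrite [leLHS]SE mulr_sumr; apply: ler_sum => i _.
rewrite /F RintegralZl// mulrC ler_wpM2r//.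
have cell_le : (mu (cell i) <= h%:E)%E.
  rewrite lebesgue_co; first by rewrite -mulrBl -natrB// subSnn mul1r.
  by rewrite ler_pM2r// ler_nat.
by apply: Rintegral_indic_le; [|exact: mcell|exact: cell_le].
Qed.

Lemma Rintegral_le_cells (L h : R) N (g : R -> R) (G : nat -> R) :
  0 < h -> L = N%:R * h -> (forall i, 0 <= G i) ->
  mu.-integrable `]0, L[ (EFin \o g) ->
  (forall i, (i < N)%N -> {ae mu, forall x, x \in `]0, L[ ->
     i%:R * h <= x < i.+1%:R * h -> g x <= G i}) ->
  \int[mu]_(x in `]0, L[) g x <= h * \sum_(i < N) G i.
Proof.
move=> h0 LE G0 gi gG.
have [Si Sle] := step_fun_integral L N G h0.
apply: (le_trans _ (Sle G0)); apply: ae_le_Rintegral => //.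
have : {ae mu, forall x (n : nat), (n < N)%N -> x \in `]0, L[ ->
    n%:R * h <= x < n.+1%:R * h -> g x <= G n}.
  apply: ae_foralln => n; have [nN|nN] := ltnP n N; last first.
    exact: aeW.
  by apply: (ae_imply _ (gG n nN)) => x H _.
apply: ae_imply => x H xL; have := xL; rewrite /= in_itv/= LE => /andP[x0 xN].
have [i iN ix] := cell_index h0 (ltW x0) xN.
by rewrite (step_funE _ h0 iN ix) (H i iN _ ix).
Qed.

Lemma cell_mean_between (p q A B : R) (g : R -> R) : p < q ->
  mu.-integrable `]p, q[ (EFin \o g) ->
  {ae mu, forall x, x \in `]p, q[ -> A <= g x <= B} ->
  A <= (q - p)^-1 * \int[mu]_(x in `]p, q[) g x <= B.
Proof.
move=> pq gi gAB; have qp : 0 < q - p by rewrite subr_gt0.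
have ci c : mu.-integrable `]p, q[ (EFin \o (fun=> c : R)).
  apply: (ae_bounded_integrable (K := `|c|)) => //; first exact: lebesgue_oo_fin.
  exact: aeW.
have cE c : \int[mu]_(x in `]p, q[) c = c * (q - p).
  rewrite Rintegral_cst//; congr *%R.
  by rewrite -[RHS]/(fine (q - p)%:E) -lebesgue_oo ?(ltW pq).
rewrite mulrC ler_pdivlMr// ler_pdivrMr// -!cE; apply/andP; split;
  apply: ae_le_Rintegral => //; apply: (ae_imply _ gAB) => x H xpq;
  by have /andP[] := H xpq.
Qed.

End lebesgue.

(** * Data of bounded variation *)

Section data.
Context {R : realType}.
Local Notation mu := (@lebesgue_measure R).

(** Every value outside the essential range lies in a ball with rational centre
and radius whose preimage is null, and there are countably many such balls. *)
Lemma ess_range_ae (p q A B : R) (g : R -> R) : measurable_fun `]p, q[ g ->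
  ess_range p q g `<=` [set` `[A, B]] ->
  {ae mu, forall x, x \in `]p, q[ -> A <= g x <= B}.
Proof.
move=> mg gAB.
pose S (c r : rat) := `]p, q[ `&` g @^-1` ball (ratr c : R) (ratr r : R).
have mS c r : measurable (S c r).
  by apply: mg => //; exact: measurable_ball.
pose P (n : nat) x := if unpickle n is Some cr then
  mu (S cr.1 cr.2) = 0%E -> ~ S cr.1 cr.2 x else True.
have : {ae mu, forall x n, P n x}.
  apply: ae_foralln => n; rewrite /P.
  case: (unpickle n) => [[c r]|]; last exact: aeW.
  have [S0|S0] := pselect (mu (S c r) = 0%E); last by apply: aeW.
  exists (S c r); split; [exact: mS|exact: S0|] => x /= H; apply: contrapT => Sx; apply: H.
  by move=> _; exact: Sx.
apply: ae_imply => x Px xpq; apply: contrapT => gx.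
have /existsNP[e] : ~ ess_range p q g (g x).
  by move=> /gAB; rewrite /= in_itv/=; exact: gx.
move=> /not_implyP[e0 /negP]; rewrite -leNgt => mu0.
have [r] : exists r : rat, (ratr r : R) \in `]e / 4, e / 2[.
  have /rat_in_itvoo[r re] : e / 4 < e / 2 by lra.
  by exists r.
rewrite in_itv/= => /andP[r4 r2].
have [c] : exists c : rat, (ratr c : R) \in `]g x - e / 4, g x + e / 4[.
  have /rat_in_itvoo[c ce] : g x - e / 4 < g x + e / 4 by lra.
  by exists c.
rewrite in_itv/= => /andP[c1 c2].
have := Px (pickle (c, r)); rewrite /P pickleK/=; apply.
  apply/eqP; rewrite eq_le measure_ge0 andbT (le_trans _ mu0)//.
  apply: le_outer_measure => y [ypq]; rewrite /ball/= => H; split => //.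
  rewrite /ball/=; move: H; rewrite !ltr_norml => /andP[]; lra.
split => //; rewrite /ball/= ltr_norml; lra.
Qed.

Lemma data_interval_convex (L T : R) (u0 a : R -> R) x y z :
  data_interval L T u0 a x -> data_interval L T u0 a y -> x <= z <= y ->
  data_interval L T u0 a z.
Proof.
move=> Dx Dy /andP[xz zy] I HI; have := Dx I HI; have := Dy I HI.
rewrite /= !in_itv/= => /andP[_ yI] /andP[Ix _].
by rewrite (le_trans Ix xz) (le_trans zy yI).
Qed.

Lemma cell_subset (L h : R) (k N : nat) : 0 < h -> L = N%:R * h -> (k < N)%N ->
  `]k%:R * h, k.+1%:R * h[ `<=` `]0, L[.
Proof.
move=> h0 -> kN x; rewrite /= !in_itv/= => /andP[kx xk].
rewrite (le_lt_trans _ kx) ?mulr_ge0 ?(ltW h0)//= (lt_le_trans xk)//.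
by rewrite ler_pM2r// ler_nat.
Qed.

Lemma cell_mean_ge_le (L h A B : R) (k N : nat) (g : R -> R) :
  0 < h -> L = N%:R * h -> (k < N)%N ->
  mu.-integrable `]0, L[ (EFin \o g) ->
  {ae mu, forall x, x \in `]0, L[ -> k%:R * h <= x <= k.+1%:R * h ->
    A <= g x <= B} ->
  A <= cell_mean h g k <= B.
Proof.
move=> h0 LE kN gi gAB.
have pq : k%:R * h < k.+1%:R * h by rewrite ltr_pM2r// ltr_nat.
have e : h = k.+1%:R * h - k%:R * h by rewrite -mulrBl -natrB// subSnn mul1r.
rewrite /cell_mean {1 4}e; apply: cell_mean_between => //.
  by apply: integrableS gi => //; exact: cell_subset LE kN.
apply: (ae_imply _ gAB) => x H xk; apply: H; first exact: (cell_subset h0 LE kN).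
by move: xk; rewrite in_itv/= => /andP[/ltW-> /ltW->].
Qed.

Section bounded_variation.
Variables (L : R) (g gt W : R -> R).
Hypothesis L_gt0 : 0 < L.
Hypothesis g_int : mu.-integrable `]0, L[ (EFin \o g).
Hypothesis g_gt : {ae mu, forall x, x \in `]0, L[ -> g x = gt x}.
Hypothesis gtW : forall x y, 0 <= x -> x <= y -> y <= L ->
  `|gt y - gt x| <= W y - W x.

Let B := `|gt 0| + (W L - W 0).

Lemma BV_ge0 : 0 <= W L - W 0.
Proof. by rewrite (le_trans _ (gtW _ _ _)) ?(ltW L_gt0). Qed.

Lemma BV_bounded : {ae mu, forall x, x \in `]0, L[ -> `|g x| <= B}.
Proof.
apply: (ae_imply _ g_gt) => x /[swap] xL /(_ xL) ->.
move: xL; rewrite in_itv/= => /andP[/ltW x0 /ltW xL].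
have -> : gt x = gt 0 + (gt x - gt 0) by lra.
rewrite (le_trans (ler_normD _ _))// lerD2l (le_trans (gtW _ _ _))//.
by rewrite lerD2r -subr_ge0 (le_trans _ (gtW x0 xL (lexx _))).
Qed.

Variables (h : R) (N : nat).
Hypotheses (h_gt0 : 0 < h) (LE : L = N%:R * h).

Definition cell_osc k := W (k.+1%:R * h) - W (k%:R * h).

Lemma sum_cell_osc : \sum_(k < N) cell_osc k = W L - W 0.
Proof.
rewrite /cell_osc LE -{2}[0](mul0r h).
elim: (N) => [|n IH]; first by rewrite big_ord0 subrr.
by rewrite big_ord_recr/= IH; ring.
Qed.

Lemma cell_dev k x : (k < N)%N -> k%:R * h <= x <= k.+1%:R * h ->
  `|gt x - gt (k%:R * h)| <= cell_osc k.
Proof.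
move=> kN /andP[kx xk].
have kL : k.+1%:R * h <= L by rewrite LE ler_pM2r// ler_nat.
have k0 : 0 <= k%:R * h by rewrite mulr_ge0 ?(ltW h_gt0).
rewrite (le_trans (gtW _ _ _)) ?(le_trans xk)// /cell_osc lerD2r.
by rewrite -subr_ge0 (le_trans _ (gtW _ xk kL))// (le_trans k0).
Qed.

Lemma cell_osc_ge0 k : (k < N)%N -> 0 <= cell_osc k.
Proof.
move=> kN; rewrite (le_trans _ (@cell_dev k (k%:R * h) _ _))//.
by rewrite lexx ler_pM2r// ler_nat leqnSn.
Qed.

Lemma cell_mean_dev k : (k < N)%N ->
  `|cell_mean h g k - gt (k%:R * h)| <= cell_osc k.
Proof.
move=> kN; rewrite ler_distl.
apply: (cell_mean_ge_le h_gt0 LE kN g_int).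
apply: (ae_imply _ g_gt) => x gx xL xk.
by rewrite (gx xL) -ler_distl cell_dev.
Qed.

Lemma BV_cell_dev k : (k < N)%N -> {ae mu, forall x, x \in `]0, L[ ->
  k%:R * h <= x < k.+1%:R * h -> `|g x - cell_mean h g k| <= cell_osc k *+ 2}.
Proof.
move=> kN; apply: (ae_imply _ g_gt) => x gx xL /andP[kx /ltW xk].
rewrite (gx xL) (le_trans (ler_distD (gt (k%:R * h)) _ _))// mulr2n lerD//.
  by rewrite cell_dev// kx.
by rewrite distrC cell_mean_dev.
Qed.

Lemma BV_cell_mean_increment k : (k.+1 < N)%N ->
  `|cell_mean h g k.+1 - cell_mean h g k| <= cell_osc k.+1 + cell_osc k *+ 2.
Proof.
move=> kN; have kN' : (k < N)%N by exact: ltnW.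
rewrite (le_trans (ler_distD (gt (k.+1%:R * h)) _ _))// lerD ?cell_mean_dev//.
rewrite (le_trans (ler_distD (gt (k%:R * h)) _ _))// mulr2n lerD//.
  by rewrite cell_dev// lexx ler_pM2r// ler_nat leqnSn.
by rewrite distrC cell_mean_dev.
Qed.

Lemma BV_cell_mean_bounded k : (k < N)%N -> `|cell_mean h g k| <= B.
Proof.
move=> kN; rewrite ler_norml; apply: (cell_mean_ge_le h_gt0 LE kN g_int).
by apply: (ae_imply _ BV_bounded) => x gx xL _; rewrite -ler_norml gx.
Qed.

Lemma BV_cell_mean_TV n : (n < N)%N ->
  \sum_(k < n) `|cell_mean h g k.+1 - cell_mean h g k| <= (W L - W 0) *+ 3.
Proof.
move=> nN; rewrite -sum_cell_osc.
apply: (@le_trans _ _ (\sum_(k < n) cell_osc k.+1 + (\sum_(k < n) cell_osc k) *+ 2)).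
  rewrite -sumrMnl -big_split/=; apply: ler_sum => k _.
  by apply: BV_cell_mean_increment; rewrite (leq_ltn_trans _ nN).
have H m : (m <= N)%N -> \sum_(k < m) cell_osc k <= \sum_(k < N) cell_osc k.
  move=> mN; rewrite -(subnKC mN) big_split_ord/= lerDl sumr_ge0// => k _.
  by apply: cell_osc_ge0; rewrite -ltn_subRL.
rewrite [leRHS]mulrS lerD//; last by rewrite lerMn2r H// ltnW.
rewrite (le_trans _ (H _ nN))// big_ord_recl/= lerDr cell_osc_ge0//.
exact: leq_ltn_trans nN.
Qed.

End bounded_variation.

Lemma L1_BV_modulus (L : R) (g : R -> R) : 0 < L -> L1_BV 0 L g ->
  mu.-integrable `]0, L[ (EFin \o g) /\
  exists gt W : R -> R,
    {ae mu, forall x, x \in `]0, L[ -> g x = gt x} /\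
    forall x y, 0 <= x -> x <= y -> y <= L -> `|gt y - gt x| <= W y - W x.
Proof.
move=> L0 [gi [gt ggt bv]]; split => //.
exists gt, (fun x => fine (total_variation 0 x gt)); split => // x y x0 xy yL.
have bvy : bounded_variation 0 y gt.
  by apply: bounded_variationl yL bv; exact: le_trans xy.
have /bounded_variationP fy := bvy.
have := fy (le_trans x0 xy); rewrite (total_variationD _ x0 xy) fin_numD.
move=> /andP[fx fxy]; rewrite fineD// addrAC subrr add0r.
by rewrite -lee_fin fineK// total_variation_ge.
Qed.

End data.

(** * Kernel weights of the cells of a grid *)

Section grid_weights.
Context {R : realType}.
Variables (th om : R -> R) (B eps h : R).
Hypotheses (dth : forall x : R, is_derive x 1 th (om x))
  (th_mono : {homo th : x y / x <= y}) (th_le0 : forall x, x <= 0 -> th x = 0)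
  (th_ge1 : forall x, 1 <= x -> th x = 1).
Hypotheses (B_ge0 : 0 <= B) (om_bnd : forall x, 0 <= om x <= B)
  (om_lt0 : forall x, x < 0 -> om x = 0) (om_gt1 : forall x, 1 < x -> om x = 0)
  (om_lip : forall x y, `|om y - om x| <= B * `|y - x|).
Hypotheses (eps_gt0 : 0 < eps) (h_gt0 : 0 < h).

Definition grid_weight j x := cell_weight th eps (j%:R * h) (j.+1%:R * h) x.
Definition grid_kernel j x := mollifier om eps (j%:R * h) x.
(** The points whose average sees the cell [j]. *)
Definition grid_window j : set R := `[j%:R * h - eps, j.+1%:R * h]%classic.

Lemma grid_le j : j%:R * h <= j.+1%:R * h.
Proof. by rewrite ler_pM2r// ler_nat. Qed.

Lemma grid_weight_ge0 j x : 0 <= grid_weight j x.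
Proof. exact/cell_weight_ge0/grid_le. Qed.

Lemma th_bnd x : 0 <= th x <= 1.
Proof.
apply/andP; split.
  by have [x0|/ltW x0] := leP x 0; [rewrite th_le0|rewrite -(th_le0 (lexx 0)) th_mono].
by have [x1|/ltW x1] := leP 1 x; [rewrite th_ge1|rewrite -(th_ge1 (lexx 1)) th_mono].
Qed.

Lemma grid_weight_le1 j x : grid_weight j x <= 1.
Proof.
rewrite /grid_weight /cell_weight.
by have /andP[_ ?] := th_bnd ((j.+1%:R * h - x) / eps);
   have /andP[? _] := th_bnd ((j%:R * h - x) / eps); lra.
Qed.

Lemma grid_kernel_ge0 j x : 0 <= grid_kernel j x.
Proof.
by rewrite /grid_kernel /mollifier divr_ge0 ?(ltW eps_gt0)//; case/andP: (om_bnd ((j%:R * h - x) / eps)).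
Qed.

Lemma grid_kernel_le j x : grid_kernel j x <= B / eps.
Proof.
rewrite /grid_kernel /mollifier ler_pM2r ?invr_gt0//.
by case/andP: (om_bnd ((j%:R * h - x) / eps)).
Qed.

Lemma sum_grid_weight n x : 0 <= x -> x + eps <= n%:R * h ->
  \sum_(j < n) grid_weight j x = 1.
Proof.
move=> x0 xn; rewrite /grid_weight /cell_weight.
transitivity (th ((n%:R * h - x) / eps) - th ((0%:R * h - x) / eps)).
  elim: (n) => [|m IH]; first by rewrite big_ord0 subrr.
  by rewrite big_ord_recr/= IH; ring.
rewrite th_ge1 ?th_le0 ?subr0//; last by rewrite ler_pdivlMr//; lra.
by rewrite pmulr_lle0 ?invr_gt0//; lra.
Qed.

Lemma grid_weight_support i j K x : i%:R * h <= x < i.+1%:R * h ->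
  eps <= K%:R * h -> grid_weight j x != 0 -> (i <= j <= i + K)%N.
Proof.
move=> /andP[ix xi] epsK; apply: contraR; rewrite negb_and -!ltnNge.
rewrite /grid_weight /cell_weight => /orP[ji|ij].
  have H : j.+1%:R * h <= i%:R * h by rewrite ler_pM2r// ler_nat.
  have H' := grid_le j.
  rewrite !th_le0 ?subrr// pmulr_lle0 ?invr_gt0//; lra.
have H : (i.+1 + K)%:R * h <= j%:R * h by rewrite ler_pM2r// ler_nat.
have H' := grid_le j.
rewrite natrD mulrDl in H.
rewrite !th_ge1 ?subrr// ler_pdivlMr//; lra.
Qed.

Lemma grid_kernel0 x : 0 < x -> grid_kernel 0 x = 0.
Proof.
move=> x0; rewrite /grid_kernel /mollifier om_lt0 ?mul0r// pmulr_llt0 ?invr_gt0//; lra.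
Qed.

Lemma grid_kernel_far j x : x + eps < j%:R * h -> grid_kernel j x = 0.
Proof.
move=> xj; rewrite /grid_kernel /mollifier om_gt1 ?mul0r// ltr_pdivlMr//; lra.
Qed.

Lemma grid_weight_far j x : x + eps <= j%:R * h -> grid_weight j x = 0.
Proof.
move=> xj; have H' := grid_le j; rewrite /grid_weight /cell_weight.
rewrite !th_ge1 ?subrr// ler_pdivlMr//; lra.
Qed.

Let grid_window_out j x : ~ grid_window j x ->
  x < j%:R * h - eps \/ j.+1%:R * h < x.
Proof.
rewrite /grid_window/= in_itv/= => /negP; rewrite negb_and -!ltNge => /orP[|]; tauto.
Qed.

Lemma grid_kernel_window j x : grid_kernel j x <= B / eps * \1_(grid_window j) x.
Proof.
have [xw|xw] := pselect (grid_window j x).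
  by rewrite indicE mem_set// mulr1 grid_kernel_le.
rewrite indicE memNset// mulr0; have H' := grid_le j.
have [xl|xl] := grid_window_out xw; first by rewrite grid_kernel_far//; lra.
rewrite /grid_kernel /mollifier om_lt0 ?mul0r// pmulr_llt0 ?invr_gt0//; lra.
Qed.

Lemma grid_kernel_windowS j x : grid_kernel j.+1 x <= B / eps * \1_(grid_window j) x.
Proof.
have [xw|xw] := pselect (grid_window j x).
  by rewrite indicE mem_set// mulr1 grid_kernel_le.
rewrite indicE memNset// mulr0; have H' := grid_le j.
have [xl|xl] := grid_window_out xw; first by rewrite grid_kernel_far//; lra.
rewrite /grid_kernel /mollifier om_lt0 ?mul0r// pmulr_llt0 ?invr_gt0//; lra.
Qed.

(** The mean value theorem turns the weight of a cell into [h] times the kernel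
at some point of the cell, and the kernel is Lipschitz with constant
[B / eps ^ 2]. *)
Lemma grid_weight_kernel j y x : j%:R * h <= y <= j.+1%:R * h ->
  `|grid_weight j x - h * mollifier om eps y x| <=
  B * (h / eps) ^+ 2 * \1_(grid_window j) x.
Proof.
move=> /andP[jy yj]; have hS : j.+1%:R * h = j%:R * h + h.
  by rewrite -natr1 mulrDl mul1r.
have [xw|xw] := pselect (grid_window j x); last first.
  rewrite indicE memNset// mulr0 le_eqVlt; apply/orP; left.
  rewrite normr_eq0; apply/eqP; rewrite /grid_weight /cell_weight /mollifier.
  have [xl|xl] := grid_window_out xw.
    rewrite !th_ge1 ?om_gt1 ?mul0r ?mulr0 ?subrr//;
      rewrite ?ltr_pdivlMr ?ler_pdivlMr//; lra.
  rewrite !th_le0 ?om_lt0 ?mul0r ?mulr0 ?subrr//;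
    rewrite ?pmulr_llt0 ?pmulr_lle0 ?invr_gt0//; lra.
rewrite indicE mem_set// mulr1.
have cth : continuous th by apply: derivable_continuous => z; case: (dth z).
set q := (j.+1%:R * h - x) / eps; set p := (j%:R * h - x) / eps.
have pq : p <= q by rewrite ler_pM2r ?invr_gt0//; lra.
have [c cpq E] := MVT_segment pq (fun z _ => dth z) (continuous_subspaceT cth).
have qp : q - p = h / eps by rewrite -mulrBl hS; congr (_ / _); ring.
have -> : grid_weight j x - h * mollifier om eps y x =
    h / eps * (om c - om ((y - x) / eps)).
  rewrite /grid_weight /cell_weight -/q -/p E qp /mollifier; ring.
have he : 0 <= h / eps by rewrite divr_ge0 ?ltW.
rewrite normrM (ger0_norm he) expr2 mulrCA ler_wpM2l//.
rewrite (le_trans (om_lip _ _))// ler_wpM2l// -qp.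
move: cpq; rewrite in_itv/= => /andP[pc cq].
have py : p <= (y - x) / eps by rewrite ler_pM2r ?invr_gt0//; lra.
have yq : (y - x) / eps <= q by rewrite ler_pM2r ?invr_gt0//; lra.
rewrite ler_norml; lra.
Qed.

Lemma grid_weight0_le x : 0 < x -> grid_weight 0 x <= \1_(`[0, h]%classic) x.
Proof.
move=> x0; have [xh|xh] := leP x h.
  rewrite indicE mem_set/= ?grid_weight_le1// in_itv/=; lra.
rewrite indicE memNset/=; last by rewrite in_itv/= => /andP[_]; lra.
rewrite /grid_weight /cell_weight !th_le0 ?subrr//;
  rewrite pmulr_lle0 ?invr_gt0//; lra.
Qed.

End grid_weights.

(** * The entropy inequality, summed over the cells *)

Lemma Rintegral_sum2 d (T : measurableType d) (R : realType)
    (mu : {measure set T -> \bar R}) (D : set T) J P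
    (F : nat -> nat -> T -> R) : measurable D ->
  (forall j n, mu.-integrable D (EFin \o F j n)) ->
  mu.-integrable D (EFin \o (fun x => \sum_(j < J) \sum_(n < P) F j n x)) /\
  \int[mu]_(x in D) (\sum_(j < J) \sum_(n < P) F j n x) =
  \sum_(j < J) \sum_(n < P) \int[mu]_(x in D) F j n x.
Proof.
move=> mD Fi.
have H j := @Rintegral_sum _ _ _ mu D 'I_P (index_enum _) (fun n => F j n) mD
  (fun n => Fi j n).
have [Si ->] := @Rintegral_sum _ _ _ mu D 'I_J (index_enum _)
  (fun j x => \sum_(n < P) F j n x) mD (fun j => proj1 (H j)).
by split => //; apply: eq_bigr => j _; case: (H j).
Qed.

Section error_estimate.
Context {R : realType}.
Local Notation mu := (@lebesgue_measure R).
Variables (L T : R) (f u0 : R -> R) (u : R -> R -> R) (gam0 gamL : R -> R).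
Hypotheses (L_gt0 : 0 < L) (T_gt0 : 0 < T).
Hypotheses (f_ndecr : {homo f : x y / x <= y}) (f_cont : continuous f).
Hypothesis u_bnd : in_Linfty L T u.
Hypothesis uT_int : mu.-integrable `]0, L[ (fun x => (u x T)%:E).
Hypothesis u0_int : mu.-integrable `]0, L[ (EFin \o u0).
Hypothesis gam0_meas : measurable_fun `]0, T[ gam0.
Hypothesis gam0_bnd : exists K : R, {ae mu, forall t, t \in `]0, T[ -> `|gam0 t| <= K}.
Hypothesis u_entropy : entropy_inequality L T f u0 u gam0 gamL.

Variables (th om : R -> R) (B eps : R).
Hypotheses (Cth : forall k, Ck k th) (dth : forall x : R, is_derive x 1 th (om x))
  (th_mono : {homo th : x y / x <= y}) (th_le0 : forall x, x <= 0 -> th x = 0)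
  (th_ge1 : forall x, 1 <= x -> th x = 1).
Hypotheses (B_ge0 : 0 <= B) (om_bnd : forall x, 0 <= om x <= B).
Hypothesis eps_gt0 : 0 < eps.
Variables (dx dt : R).
Hypotheses (dx_gt0 : 0 < dx) (dt_gt0 : 0 < dt).

Local Notation psi := (grid_weight th eps dx).
Local Notation chi := (grid_weight th eps dt).
Local Notation Z := (grid_kernel om eps dx).
Local Notation W := (grid_kernel om eps dt).
Local Notation rect := (`]0, L[%classic `*` `]0, T[%classic : set (R * R)).

Lemma flux_bounded (K v : R) : `|v| <= K -> `|f v| <= `|f (- K)| + `|f K|.
Proof.
rewrite ler_norml => /andP[Kv vK].
have := f_ndecr Kv; have := f_ndecr vK.
have := ler_norm (f K); have := ler_norm (- f (- K)); rewrite normrN.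
have := normr_ge0 (f K); have := normr_ge0 (f (- K)).
rewrite ler_norml; lra.
Qed.

Lemma measurable_rect : measurable rect.
Proof. exact: measurableX. Qed.

Lemma rect_fin : ((mu \x mu)%E rect < +oo)%E.
Proof.
have -> : (mu \x mu)%E rect = (mu `]0%R, L[ * mu `]0%R, T[)%E.
  exact: product_measure1E.
by rewrite !lebesgue_oo ?ltW// -EFinM ltry.
Qed.

Lemma continuous_grid_weight h j : continuous (grid_weight th eps h j).
Proof. exact: continuous_cell_weight. Qed.

Lemma continuous_grid_kernel h j : continuous (grid_kernel om eps h j).
Proof.
apply: continuous_mollifier; rewrite -(is_derive_derive1 dth).
by have [_ +] := Cth 1%N; apply.
Qed.

(** The integrand over the rectangle of the entropy inequality for the cell
[(j, n)], once the test function is differentiated. *)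
Definition interior_integrand (c : R) j n (z : R * R) : R :=
  `|u z.1 z.2 - c| * (psi j z.1 * (W n z.2 - W n.+1 z.2)) +
  `|f (u z.1 z.2) - f c| * ((Z j z.1 - Z j.+1 z.1) * chi n z.2).

Lemma integrable_interior c j n :
  (mu \x mu)%E.-integrable rect (EFin \o interior_integrand c j n).
Proof.
have [mu_u [K uK]] := u_bnd.
pose K1 := (K + `|c|) * (B / eps + B / eps) +
  (`|f (- K)| + `|f K| + `|f c|) * (B / eps + B / eps).
apply: (ae_bounded_integrable (K := K1)).
- exact: measurable_rect.
- exact: rect_fin.
- have mfst (g : R -> R) : continuous g -> measurable_fun rect (fun z : R * R => g z.1).
    move=> cg; apply: measurable_funTS; apply: measurableT_comp => //.
    exact: continuous_measurable_fun.
  have msnd (g : R -> R) : continuous g -> measurable_fun rect (fun z : R * R => g z.2).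
    move=> cg; apply: measurable_funTS; apply: measurableT_comp => //.
    exact: continuous_measurable_fun.
  have mfu : measurable_fun rect (fun z : R * R => f (u z.1 z.2)).
    apply: (measurableT_comp (continuous_measurable_fun f_cont) mu_u).
  have cB (g h : R -> R) : continuous g -> continuous h -> continuous (g \- h).
    by move=> cg ch x; apply: cvgB; [exact: cg|exact: ch].
  apply: measurable_funD; apply: measurable_funM.
  + by apply: measurableT_comp => //; exact: measurable_funB.
  + apply: measurable_funM; first by apply: (mfst (psi j)); exact: continuous_grid_weight.
    apply: (msnd (W n \- W n.+1)).
    by apply: cB; exact: continuous_grid_kernel.
  + by apply: measurableT_comp => //; exact: measurable_funB.
  + apply: measurable_funM; last by apply: (msnd (chi n)); exact: continuous_grid_weight.
    apply: (mfst (Z j \- Z j.+1)).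
    by apply: cB; exact: continuous_grid_kernel.
- have dk h i y : `|grid_kernel om eps h i y - grid_kernel om eps h i.+1 y| <=
      B / eps + B / eps.
    have := grid_kernel_ge0 h om_bnd eps_gt0 i y.
    have := grid_kernel_ge0 h om_bnd eps_gt0 i.+1 y.
    have := grid_kernel_le h om_bnd eps_gt0 i y.
    have := grid_kernel_le h om_bnd eps_gt0 i.+1 y.
    rewrite ler_norml; lra.
  have w1 h i y : 0 < h -> `|grid_weight th eps h i y| <= 1.
    by move=> h0; rewrite ger0_norm ?grid_weight_le1 ?grid_weight_ge0.
  apply: (ae_imply _ uK) => -[x t] /= H [/= xL tT]; have {}H := H xL tT.
  rewrite /interior_integrand /= /K1 (le_trans (ler_normD _ _))// lerD//.
    rewrite !normrM normr_id ler_pM ?mulr_ge0//.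
      by rewrite (le_trans (ler_normB _ _))// lerD2r.
    by rewrite -[leRHS]mul1r ler_pM ?w1.
  rewrite !normrM normr_id ler_pM ?mulr_ge0//.
    by rewrite (le_trans (ler_normB _ _))// lerD2r flux_bounded.
  by rewrite -[leRHS]mulr1 ler_pM ?w1.
Qed.

Lemma integrable_flux_gam0 : mu.-integrable `]0, T[ (EFin \o (f \o gam0)).
Proof.
have [K gK] := gam0_bnd.
apply: (ae_bounded_integrable (K := `|f (- K)| + `|f K|)) => //.
- exact: lebesgue_oo_fin.
- exact: (measurableT_comp (continuous_measurable_fun f_cont) gam0_meas).
- by apply: (ae_imply _ gK) => t H tT; apply: flux_bounded; exact: H.
Qed.

Lemma grid_weightM_le1 h h' i j x y : 0 < h -> 0 < h' ->
  `|grid_weight th eps h i x * grid_weight th eps h' j y| <= 1.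
Proof.
move=> h0 h'0; rewrite normrM mulr_ile1// ger0_norm
  ?grid_weight_le1 ?grid_weight_ge0//.
Qed.

Lemma integrable_final c j n :
  mu.-integrable `]0, L[ (EFin \o (fun x => `|u x T - c| * (psi j x * chi n T))).
Proof.
apply: integrable_weighted => //; first exact: lebesgue_oo_fin.
  apply: measurable_funTS; apply: continuous_measurable_fun => x.
  by apply: cvgMl; exact: continuous_grid_weight.
by move=> x; exact: grid_weightM_le1.
Qed.

Lemma integrable_initial c j n :
  mu.-integrable `]0, L[ (EFin \o (fun x => `|u0 x - c| * (psi j x * chi n 0))).
Proof.
apply: integrable_weighted => //; first exact: lebesgue_oo_fin.
  apply: measurable_funTS; apply: continuous_measurable_fun => x.
  by apply: cvgMl; exact: continuous_grid_weight.
by move=> x; exact: grid_weightM_le1.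
Qed.

Lemma integrable_inflow c j n :
  mu.-integrable `]0, T[
    (EFin \o (fun t => `|f (gam0 t) - f c| * (psi j 0 * chi n t))).
Proof.
apply: (@integrable_weighted _ _ _ mu _ (f \o gam0)) => //.
- exact: lebesgue_oo_fin.
- exact: integrable_flux_gam0.
- apply: measurable_funTS; apply: continuous_measurable_fun => x.
  by apply: cvgMr; exact: continuous_grid_weight.
- by move=> x; exact: grid_weightM_le1.
Qed.

(** The outflow term at [x = L] and the terminal term enter with the same sign;
the former is nonnegative and is dropped, the latter is kept. *)
Lemma entropy_cell c j n :
  \int[mu]_(x in `]0, L[) (`|u x T - c| * (psi j x * chi n T)) <=
  \int[(mu \x mu)%E]_(z in rect) interior_integrand c j n z +
  \int[mu]_(x in `]0, L[) (`|u0 x - c| * (psi j x * chi n 0)) +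
  \int[mu]_(t in `]0, T[) (`|f (gam0 t) - f c| * (psi j 0 * chi n t)).
Proof.
have := u_entropy c (test_cell_weight Cth th_mono eps_gt0 L T
  (grid_le dx_gt0 j) (grid_le dt_gt0 n)).
rewrite -(Rintegral_iterated _ _ (integrable_interior c j n))//.
have -> : \int[mu]_(t in `]0, T[) \int[mu]_(x in `]0, L[)
     (`|u x t - c| * 'D_(0, 1) (tensor (psi j) (chi n)) (x, t) +
      `|f (u x t) - f c| * 'D_(1, 0) (tensor (psi j) (chi n)) (x, t)) =
   \int[mu]_(t in `]0, T[) \int[mu]_(x in `]0, L[) interior_integrand c j n (x, t).
  apply: eq_Rintegral => t _; apply: eq_Rintegral => x _.
  by rewrite /interior_integrand (derive_cell_weight1 _ dth)
             (derive_cell_weight2 _ dth).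
have out : 0 <= \int[mu]_(t in `]0, T[)
    (`|f (gamL t) - f c| * tensor (psi j) (chi n) (L, t)).
  by apply: Rintegral_ge0 => t _; rewrite !mulr_ge0// grid_weight_ge0.
have alg (I1 I2 I3 I4 I5 : R) :
    0 <= I1 - I2 + I3 + I4 - I5 -> 0 <= I5 -> I2 <= I1 + I3 + I4 by lra.
by move=> H; exact: alg H out.
Qed.

Lemma entropy_sum (w : nat -> nat -> R) J P :
  \int[mu]_(x in `]0, L[) (\sum_(j < J) \sum_(n < P)
     `|u x T - w n j| * (psi j x * chi n T)) <=
  \int[(mu \x mu)%E]_(z in rect) (\sum_(j < J) \sum_(n < P)
     interior_integrand (w n j) j n z) +
  \int[mu]_(x in `]0, L[) (\sum_(j < J) \sum_(n < P)
     `|u0 x - w n j| * (psi j x * chi n 0)) +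
  \int[mu]_(t in `]0, T[) (\sum_(j < J) \sum_(n < P)
     `|f (gam0 t) - f (w n j)| * (psi j 0 * chi n t)).
Proof.
have [_ ->] := @Rintegral_sum2 _ _ _ mu `]0, L[%classic J P
  (fun j n x => `|u x T - w n j| * (psi j x * chi n T)) (measurable_itv _)
  (fun j n => integrable_final (w n j) j n).
have [_ ->] := @Rintegral_sum2 _ _ _ (mu \x mu)%E rect J P
  (fun j n => interior_integrand (w n j) j n) measurable_rect
  (fun j n => integrable_interior (w n j) j n).
have [_ ->] := @Rintegral_sum2 _ _ _ mu `]0, L[%classic J P
  (fun j n x => `|u0 x - w n j| * (psi j x * chi n 0)) (measurable_itv _)
  (fun j n => integrable_initial (w n j) j n).
have [_ ->] := @Rintegral_sum2 _ _ _ mu `]0, T[%classic J P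
  (fun j n t => `|f (gam0 t) - f (w n j)| * (psi j 0 * chi n t)) (measurable_itv _)
  (fun j n => integrable_inflow (w n j) j n).
rewrite -!big_split/=; apply: ler_sum => j _.
by rewrite -!big_split/=; apply: ler_sum => n _; exact: entropy_cell.
Qed.



(** * The error estimate *)

Hypotheses (om_lt0 : forall x, x < 0 -> om x = 0)
  (om_gt1 : forall x, 1 < x -> om x = 0)
  (om_lip : forall x y, `|om y - om x| <= B * `|y - x|).
Variables (lam : R) (N M K K' : nat).
Hypotheses (lam_gt0 : 0 < lam) (dtE : dt = lam * dx).
Hypotheses (LE : L = N%:R * dx) (TE : T = M.+1%:R * dt).
Hypotheses (epsK : eps <= K%:R * dx) (epsK' : eps <= K'%:R * dt).
Variable w : nat -> nat -> R.
Hypothesis kruzkov : forall k n j,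
  `|w n.+1 j.+1 - k| <=
  `|w n j.+1 - k| - lam * (`|f (w n j.+1) - f k| - `|f (w n j) - f k|).
Hypothesis increment : forall n j,
  `|w n.+1 j.+1 - w n j.+1| = lam * `|f (w n j.+1) - f (w n j)|.
Variables (V V1 V2 V3 : R).
Hypothesis TV_space : forall n m, \sum_(j < m) `|w n j.+1 - w n j| <= V.
Hypothesis TV_boundary : forall m, \sum_(n < m) `|w n.+1 0 - w n 0| <= V.
Hypothesis L1_time : forall n m, \sum_(j < m) `|w n.+1 j - w n j| <= V1.
Hypothesis TV_time_flux : forall j m,
  \sum_(n < m) `|f (w n.+1 j) - f (w n j)| <= V2.
Hypothesis L1_space_flux : forall j m,
  \sum_(n < m) `|f (w n j.+1) - f (w n j)| <= V3.

Let J := (N + K)%N.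
Let P := (M.+1 + K')%N.
Let D := B ^+ 2 / eps ^+ 3 * (dx ^+ 2 + lam^-1 * dt ^+ 2).
Let c n j := `|w n.+1 j - w n j|.

Let box (A A' : set R) : R * R -> R := \1_(A `*` A').

Let boxE A A' (x t : R) : box A A' (x, t) = \1_A x * \1_A' t.
Proof.
rewrite /box !indicE in_setX/=.
by case: (x \in A) => /=; rewrite ?mul1r ?mul0r.
Qed.

Let xK x : x <= L -> x + eps <= J%:R * dx.
Proof. by move=> xL; rewrite natrD mulrDl -LE lerD. Qed.

Let tK' t : t <= T -> t + eps <= P%:R * dt.
Proof. by move=> tT; rewrite natrD mulrDl -TE lerD. Qed.

Let xS x : x <= L -> x + eps <= J.+1%:R * dx.
Proof. by move=> xL; rewrite (le_trans (xK xL))// ler_pM2r// ler_nat. Qed.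

Let tS t : t <= T -> t + eps <= P.+1%:R * dt.
Proof. by move=> tT; rewrite (le_trans (tK' tT))// ler_pM2r// ler_nat. Qed.

Let D_ge0 : 0 <= D.
Proof.
rewrite mulr_ge0 ?divr_ge0 ?exprn_ge0 ?(ltW eps_gt0)//.
by rewrite addr_ge0 ?mulr_ge0 ?invr_ge0 ?exprn_ge0 ?(ltW lam_gt0) ?ltW.
Qed.

Definition interior_bound (z : R * R) : R :=
  \sum_(n < P) c n 0 * (B / eps) *
     box `[0, dx]%classic (grid_window eps dt n) z +
  \sum_(j < J) \sum_(n < P) c n j.+1 * D *
     box (grid_window eps dx j.+1) (grid_window eps dt n) z.

Lemma interior_le z : rect z ->
  \sum_(j < J.+1) \sum_(n < P.+1) interior_integrand (w n j) j n z <=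
  interior_bound z.
Proof.
case: z => x t [/=]; rewrite !in_itv/= => /andP[x0 xL] /andP[t0 tT].
pose r j := B * (dx / eps) ^+ 2 * (\1_(grid_window eps dx j) x : R).
pose s n := B * (dt / eps) ^+ 2 * (\1_(grid_window eps dt n) t : R).
have dS (h : R) j : 0 < h -> j%:R * h <= j%:R * h <= j.+1%:R * h.
  by move=> h0; rewrite lexx grid_le.
have dS' (h : R) j : 0 < h -> j%:R * h <= j.+1%:R * h <= j.+1%:R * h.
  by move=> h0; rewrite lexx grid_le.
have ltxS : x + eps < J.+1%:R * dx.
  by rewrite (le_lt_trans (xK (ltW xL)))// ltr_pM2r// ltr_nat.
have lttS : t + eps < P.+1%:R * dt.
  by rewrite (le_lt_trans (tK' (ltW tT)))// ltr_pM2r// ltr_nat.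
have H := @discrete_entropy_production R f lam dx dt lam_gt0 dx_gt0 dtE w
  kruzkov increment (fun j => psi j x) (fun j => Z j x) (fun n => chi n t)
  (fun n => W n t) r s J P.
apply: (le_trans (H _ _ _ _ _ _ _ _ _ _ (u x t))) => {H}.
- by move=> j; exact: grid_weight_ge0.
- by move=> j; exact: grid_kernel_ge0 om_bnd _ _ _.
- by move=> j; exact: grid_kernel_ge0 om_bnd _ _ _.
- exact: grid_kernel0.
- exact: grid_kernel_far.
- exact: grid_kernel0.
- exact: grid_kernel_far.
- by apply: grid_weight_far => //; exact: tK' (ltW tT).
- move=> j; apply: (grid_weight_kernel dth th_le0 th_ge1) => //.
  exact: dS.
- move=> n; apply: (grid_weight_kernel dth th_le0 th_ge1) => //.
  exact: dS'.
rewrite /interior_bound; apply: lerD.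
  apply: ler_sum => n _; rewrite boxE -mulrA ler_wpM2l//.
  rewrite [leRHS]mulrCA ler_pM ?grid_weight_ge0 ?(grid_kernel_ge0 dt om_bnd eps_gt0)//.
    exact: grid_weight0_le.
  exact: grid_kernel_windowS.
apply: ler_sum => j _; apply: ler_sum => n _; rewrite boxE -mulrA ler_wpM2l//.
set I := \1_(grid_window eps dx j.+1) x; set I' := \1_(grid_window eps dt n) t.
have I0 : 0 <= I by rewrite /I indicE.
have I'0 : 0 <= I' by rewrite /I' indicE.
have -> : D * (I * I') = B * (dx / eps) ^+ 2 * I * (B / eps * I') +
    lam^-1 * (B / eps * I * (B * (dt / eps) ^+ 2 * I')).
  by rewrite /D; field; rewrite ?gt_eqF.
have e2 (h : R) : 0 <= B * (h / eps) ^+ 2 by rewrite mulr_ge0// exprn_even_ge0.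
apply: lerD.
  by rewrite ler_wpM2l ?(mulr_ge0 (e2 _))// grid_kernel_windowS.
rewrite ler_wpM2l ?invr_ge0 ?(ltW lam_gt0)// ler_wpM2r ?(mulr_ge0 (e2 _))//.
exact: grid_kernel_window.
Qed.

Let box_integral (p q p' q' : R) : p <= q -> p' <= q' ->
  (mu \x mu)%E.-integrable rect (EFin \o box `[p, q]%classic `[p', q']%classic) /\
  \int[(mu \x mu)%E]_(z in rect) box `[p, q]%classic `[p', q']%classic z <=
    (q - p) * (q' - p').
Proof.
move=> pq pq'; have mb : measurable (`[p, q]%classic `*` `[p', q']%classic : set (R * R)).
  exact: measurableX.
split; first by apply: integrable_indic_fin => //; [exact: measurable_rect|exact: rect_fin].
apply: Rintegral_indic_le => //; first exact: measurable_rect.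
by rewrite -lebesgue_rect.
Qed.

Let window_length (h : R) j : j.+1%:R * h - (j%:R * h - eps) = h + eps.
Proof. by rewrite -natr1; ring. Qed.

Let window_le (h : R) j : 0 < h -> j%:R * h - eps <= j.+1%:R * h.
Proof.
move=> h0; rewrite (le_trans _ (grid_le h0 j))// lerBlDr lerDl.
exact: ltW.
Qed.

Definition interior_error : R :=
  V * (B / eps) * (dx * (dt + eps)) +
  (V1 *+ P) * D * ((dx + eps) * (dt + eps)).

Lemma interior_integral_le :
  \int[(mu \x mu)%E]_(z in rect)
    (\sum_(j < J.+1) \sum_(n < P.+1) interior_integrand (w n j) j n z) <=
  interior_error.
Proof.
have [Si _] := @Rintegral_sum2 _ _ _ (mu \x mu)%E rect J.+1 P.+1
  (fun j n => interior_integrand (w n j) j n) measurable_rect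
  (fun j n => integrable_interior (w n j) j n).
have c0 n j : 0 <= c n j by exact: normr_ge0.
have Be0 : 0 <= B / eps by rewrite divr_ge0 ?(ltW eps_gt0).
have len0 (h h' : R) : 0 <= h -> 0 <= h' -> 0 <= h * (h' + eps).
  by move=> h0 h'0; rewrite mulr_ge0// addr_ge0// ltW.
pose F1 n z := c n 0 * (B / eps) * box `[0, dx]%classic (grid_window eps dt n) z.
pose F2 j n z := c n j.+1 * D *
     box (grid_window eps dx j.+1) (grid_window eps dt n) z.
have b1 n := box_integral (ltW dx_gt0) (window_le n dt_gt0).
have b2 j n := box_integral (window_le j dx_gt0) (window_le n dt_gt0).
have i1 n : (mu \x mu)%E.-integrable rect (EFin \o F1 n).
  exact: (@integrableZl _ _ _ (mu \x mu)%E rect measurable_rect (c n 0 * (B / eps)) _ (proj1 (b1 n))).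
have i2 j n : (mu \x mu)%E.-integrable rect (EFin \o F2 j n).
  exact: (@integrableZl _ _ _ (mu \x mu)%E rect measurable_rect (c n j.+1 * D) _ (proj1 (b2 j.+1 n))).
have [S1 E1] := @Rintegral_sum _ _ _ (mu \x mu)%E rect 'I_P (index_enum _)
  (fun n => F1 n) measurable_rect i1.
have [S2 E2] := @Rintegral_sum2 _ _ _ (mu \x mu)%E rect J P F2 measurable_rect i2.
apply: (@le_trans _ _ (\int[(mu \x mu)%E]_(z in rect) interior_bound z)).
  apply: le_Rintegral; [exact: measurable_rect|exact: Si| |exact: interior_le].
  exact: (@integrableD _ _ _ (mu \x mu)%E rect measurable_rect _ _ S1 S2).
rewrite (@RintegralD _ _ _ (mu \x mu)%E rect _ _ measurable_rect S1 S2) E1 E2 /interior_error; apply: lerD.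
  apply: (@le_trans _ _ (\sum_(n < P) c n 0 * (B / eps) * (dx * (dt + eps)))).
    apply: ler_sum => n _; rewrite RintegralZl//; first last.
    - exact: (proj1 (b1 n)).
    - exact: measurable_rect.
    rewrite ler_wpM2l//; first by rewrite (mulr_ge0 (c0 _ _) Be0).
    by apply: le_trans (proj2 (b1 n)) _; rewrite subr0 window_length.
  rewrite -!mulr_suml ler_wpM2r//; first by rewrite len0// ltW.
  by rewrite ler_wpM2r.
apply: (@le_trans _ _ (\sum_(j < J) \sum_(n < P) c n j.+1 * (D * ((dx + eps) * (dt + eps))))).
  apply: ler_sum => j _; apply: ler_sum => n _; rewrite RintegralZl//; first last.
  - exact: (proj1 (b2 j.+1 n)).
  - exact: measurable_rect.
  rewrite [leRHS]mulrA ler_wpM2l//; first by rewrite (mulr_ge0 (c0 _ _) D_ge0).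
  by apply: le_trans (proj2 (b2 j.+1 n)) _; rewrite !window_length.
rewrite exchange_big/= -mulrA.
under eq_bigr do rewrite -mulr_suml.
rewrite -mulr_suml ler_wpM2r//.
  by rewrite (mulr_ge0 D_ge0)// len0 ?addr_ge0 ?ltW.
rewrite -[X in _ *+ X](card_ord P) -sumr_const ler_sum// => n _.
rewrite (le_trans _ (L1_time n J.+1))// big_ord_recl/= lerDr//.
Qed.


Let t_cell m : m%:R * dt <= m%:R * dt < m.+1%:R * dt.
Proof. by rewrite lexx ltr_pM2r// ltr_nat ltnSn. Qed.

Let sum_psi x : 0 <= x -> x <= L -> \sum_(j < J.+1) psi j x = 1.
Proof. by move=> x0 xL; apply: sum_grid_weight => //; exact: xS. Qed.

Let sum_chi t : 0 <= t -> t <= T -> \sum_(n < P.+1) chi n t = 1.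
Proof. by move=> t0 tT; apply: sum_grid_weight => //; exact: tS. Qed.

Let psi_supp i j x : i%:R * dx <= x < i.+1%:R * dx -> psi j x != 0 ->
  (i <= j <= i + K)%N.
Proof. by move=> ix; apply: (grid_weight_support th_le0 th_ge1 eps_gt0 dx_gt0 ix). Qed.

Let chi_supp m n t : m%:R * dt <= t < m.+1%:R * dt -> chi n t != 0 ->
  (m <= n <= m + K')%N.
Proof. by move=> mt; apply: (grid_weight_support th_le0 th_ge1 eps_gt0 dt_gt0 mt). Qed.

Definition time_avg m i := window_avg w K K' P.+1 (fun n => chi n (m%:R * dt)) m i.

(** On the line [x = 0] space and time exchange their roles, and the states are
replaced by their fluxes. *)
Definition inflow_avg n :=
  window_avg (fun j n => f (w n j)) K' K J.+1 (fun j => psi j 0) 0 n.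

Let window_avg_ge0 (g : nat -> nat -> R) k k' p (ch : nat -> R) p0 q0 :
  (forall p, 0 <= ch p) -> 0 <= window_avg g k k' p ch p0 q0.
Proof.
move=> ch0; apply: sumr_ge0 => i _; rewrite mulr_ge0// addr_ge0// sumr_ge0//.
Qed.

Let time_avg_ge0 m i : 0 <= time_avg m i.
Proof. by apply: window_avg_ge0 => n; exact: grid_weight_ge0. Qed.

Let inflow_avg_ge0 n : 0 <= inflow_avg n.
Proof. by apply: window_avg_ge0 => j; exact: grid_weight_ge0. Qed.

Let sum_time_avg m : m%:R * dt <= T ->
  \sum_(i < N) time_avg m i <= V *+ K + V1 *+ K'.
Proof.
move=> mT; apply: sum_window_avg => //; last exact: sum_chi (mulr_ge0 _ (ltW dt_gt0)) mT.
by move=> n; exact: grid_weight_ge0.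
Qed.

Let sum_inflow_avg : \sum_(n < M.+1) inflow_avg n <= V2 *+ K' + V3 *+ K.
Proof.
apply: (@sum_window_avg _ (fun j n => f (w n j))) => //.
- by move=> n; exact: grid_weight_ge0.
- by apply: sum_psi => //; exact: ltW.
Qed.

Let x_cell i x : (i < N)%N -> i%:R * dx <= x < i.+1%:R * dx -> 0 <= x <= L.
Proof.
move=> iN /andP[ix xi]; rewrite (le_trans _ ix) ?mulr_ge0 ?(ltW dx_gt0)//=.
by rewrite (le_trans (ltW xi))// LE ler_pM2r// ler_nat.
Qed.

Let integrable_terminal_error :
  mu.-integrable `]0, L[ (EFin \o (fun x => `|u x T - step_fun dx N (w M.+1) x|)).
Proof.
have [Si _] := step_fun_integral L N (w M.+1) dx_gt0.
exact: (integrable_norm (integrableB _ uT_int Si)).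
Qed.

Lemma terminal_le :
  \int[mu]_(x in `]0, L[) `|u x T - step_fun dx N (w M.+1) x| <=
  \int[mu]_(x in `]0, L[) (\sum_(j < J.+1) \sum_(n < P.+1)
     `|u x T - w n j| * (psi j x * chi n T)) +
  dx * (V *+ K + V1 *+ K').
Proof.
have [Si _] := @Rintegral_sum2 _ _ _ mu `]0, L[%classic J.+1 P.+1
  (fun j n x => `|u x T - w n j| * (psi j x * chi n T)) (measurable_itv _)
  (fun j n => integrable_final (w n j) j n).
rewrite -lerBlDl -RintegralB//.
apply: (@le_trans _ _ (dx * \sum_(i < N) time_avg M.+1 i)); last first.
  by rewrite ler_pM2l// sum_time_avg// TE.
apply: Rintegral_le_cells => //.
  exact: (integrableB _ integrable_terminal_error Si).
move=> i iN; apply: aeW => x _ ix; have /andP[x0 xL] := x_cell iN ix.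
rewrite (step_funE _ dx_gt0 iN ix) lerBlDl /time_avg -TE.
apply: (@le_avg _ w K K' P.+1 J.+1 (fun j => psi j x)).
- by move=> n; exact: grid_weight_ge0.
- by move=> n _; apply: chi_supp; rewrite TE; exact: t_cell.
- by apply: sum_chi => //; exact: ltW.
- by move=> j; exact: grid_weight_ge0.
- by move=> j _; apply: psi_supp.
- exact: sum_psi.
Qed.

Variables (osc oscA : nat -> R) (O OA : R).
Hypotheses (osc_ge0 : forall i, 0 <= osc i) (oscA_ge0 : forall i, 0 <= oscA i).
Hypotheses (sum_osc : \sum_(i < N) osc i <= O)
  (sum_oscA : \sum_(m < M.+1) oscA m <= OA).
Hypothesis u0_osc : forall i, (i < N)%N -> {ae mu, forall x, x \in `]0, L[ ->
  i%:R * dx <= x < i.+1%:R * dx -> `|u0 x - w 0 i| <= osc i}.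
Hypothesis gam0_osc : forall m, (m < M.+1)%N -> {ae mu, forall t, t \in `]0, T[ ->
  m%:R * dt <= t < m.+1%:R * dt -> `|f (gam0 t) - f (w m 0)| <= oscA m}.

Lemma initial_le :
  \int[mu]_(x in `]0, L[) (\sum_(j < J.+1) \sum_(n < P.+1)
     `|u0 x - w n j| * (psi j x * chi n 0)) <= dx * (O + (V *+ K + V1 *+ K')).
Proof.
have [Si _] := @Rintegral_sum2 _ _ _ mu `]0, L[%classic J.+1 P.+1
  (fun j n x => `|u0 x - w n j| * (psi j x * chi n 0)) (measurable_itv _)
  (fun j n => integrable_initial (w n j) j n).
apply: (@le_trans _ _ (dx * \sum_(i < N) (osc i + time_avg 0 i))); last first.
  by rewrite ler_pM2l// big_split/= lerD// sum_time_avg// mul0r ltW.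
apply: (@Rintegral_le_cells _ L dx N _ (fun i => osc i + time_avg 0 i)) => //.
  by move=> i; rewrite addr_ge0.
move=> i iN; apply: (ae_imply _ (u0_osc iN)) => x H xL ix.
have /andP[x0 xL'] := x_cell iN ix.
rewrite (le_trans _ (lerD (H xL ix) (lexx _)))// /time_avg mul0r.
apply: (@avg_le _ w K K' P.+1 J.+1 (fun j => psi j x)).
- by move=> n; exact: grid_weight_ge0.
- by move=> n _; apply: chi_supp; rewrite -[X in _ <= X < _](mul0r dt); exact: (t_cell 0).
- by apply: sum_chi => //; exact: ltW.
- by move=> j; exact: grid_weight_ge0.
- by move=> j _; apply: psi_supp.
- exact: sum_psi.
Qed.

Lemma inflow_le :
  \int[mu]_(t in `]0, T[) (\sum_(j < J.+1) \sum_(n < P.+1)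
     `|f (gam0 t) - f (w n j)| * (psi j 0 * chi n t)) <=
  dt * (OA + (V2 *+ K' + V3 *+ K)).
Proof.
have [Si _] := @Rintegral_sum2 _ _ _ mu `]0, T[%classic J.+1 P.+1
  (fun j n t => `|f (gam0 t) - f (w n j)| * (psi j 0 * chi n t)) (measurable_itv _)
  (fun j n => integrable_inflow (w n j) j n).
apply: (@le_trans _ _ (dt * \sum_(m < M.+1) (oscA m + inflow_avg m))); last first.
  by rewrite ler_pM2l// big_split/= lerD// sum_inflow_avg.
apply: (@Rintegral_le_cells _ T dt M.+1 _ (fun m => oscA m + inflow_avg m)) => //.
  by move=> m; rewrite addr_ge0.
move=> m mM; apply: (ae_imply _ (gam0_osc mM)) => t H tT mt.
rewrite (le_trans _ (lerD (H tT mt) (lexx _)))//.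
have /andP[t0 tT'] : 0 < t < T by move: tT; rewrite in_itv.
rewrite exchange_big/=; under eq_bigr do under eq_bigr do rewrite [psi _ _ * _]mulrC.
apply: (@avg_le _ (fun j n => f (w n j)) K' K J.+1 P.+1 (fun n => chi n t)).
- by move=> j; exact: grid_weight_ge0.
- move=> j _; apply: psi_supp; rewrite mul0r lexx mulr_gt0//.
- by apply: sum_psi => //; exact: ltW.
- by move=> n; exact: grid_weight_ge0.
- by move=> n _; apply: chi_supp.
- by apply: sum_chi; exact: ltW.
Qed.

Lemma error_le :
  \int[mu]_(x in `]0, L[) `|u x T - step_fun dx N (w M.+1) x| <=
  interior_error + dx * (O + (V *+ K + V1 *+ K') *+ 2) +
  dt * (OA + (V2 *+ K' + V3 *+ K)).
Proof.
have := terminal_le; have := interior_integral_le; have := initial_le.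
have := inflow_le; have := entropy_sum w J.+1 P.+1.
have alg (a b p q r s x y z k : R) : a <= b + p + q -> q <= r -> p <= x * (y + s) ->
    b <= z -> k <= a + x * s -> k <= z + x * (y + s *+ 2) + r.
  by rewrite mulr2n; lra.
exact: alg.
Qed.

End error_estimate.

(** * The constant *)

Section rate.
Context {R : realType}.
Variables (lam T B V V1 V2 V3 O OA l : R).
Hypotheses (lam_gt0 : 0 < lam) (T_gt0 : 0 < T) (B_ge0 : 0 <= B) (V_ge0 : 0 <= V)
  (V1_ge0 : 0 <= V1) (V2_ge0 : 0 <= V2) (V3_ge0 : 0 <= V3) (O_ge0 : 0 <= O)
  (OA_ge0 : 0 <= OA) (l_gt0 : 0 < l).

(** The bound of [error_le] at [eps = sqrt dx], divided by [eps] and made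
independent of [dx] by [eps <= l]: the first two summands stem from the
interior, the third from the lines [t = 0] and [t = T], the last one from
[x = 0]. *)
Definition rate_constant : R :=
  V * B * (l * (1 + lam * l)) +
  V1 * B ^+ 2 * (1 + lam) / lam *
    ((1 + l) * (1 + lam * l) * (T + (l * (1 + lam * l)))) +
  (l * O + V * 2 * (1 + l) + V1 * 2 / lam * (1 + lam * l)) +
  (lam * l * OA + V2 * (1 + lam * l) + V3 * lam * (1 + l)).

Lemma interior_error_le_rate (e dx dt : R) (M K K' : nat) :
  0 < e -> e <= l -> dx = e ^+ 2 -> dt = lam * dx ->
  T = M.+1%:R * dt -> K%:R * dx <= e + dx -> K'%:R * dt <= e + dt ->
  interior_error B e dx dt lam M K' V V1 + dx * (O + (V *+ K + V1 *+ K') *+ 2) +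
  dt * (OA + (V2 *+ K' + V3 *+ K)) <= rate_constant * e.
Proof.
move=> e0 el dxE dtE TE Kdx Kdt.
have l0 := ltW l_gt0; have lam0 := ltW lam_gt0; have e0' := ltW e0.
have kx : K%:R * dx <= e * (1 + l).
  rewrite (le_trans Kdx)// dxE mulrDr mulr1 lerD2l expr2 ler_pM2l//.
have kt : K'%:R * dt <= e * (1 + lam * l).
  rewrite (le_trans Kdt)// dtE dxE mulrDr mulr1 lerD2l expr2 mulrCA ler_pM2l//.
  by rewrite ler_pM2l.
have e2 : e ^+ 2 <= e * l by rewrite expr2 ler_pM2l.
have pt : (M.+1 + K')%:R * dt <= T + l * (1 + lam * l).
  rewrite natrD mulrDl -TE lerD2l (le_trans kt)// ler_wpM2r//.
  by rewrite addr_ge0// mulr_ge0.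
have lam1 : 0 <= 1 + lam by rewrite addr_ge0.
have laml : 0 <= 1 + lam * l by rewrite addr_ge0// mulr_ge0.
have lame : 1 + lam * e <= 1 + lam * l by rewrite lerD2l ler_pM2l.
have lame0 : 0 <= 1 + lam * e by rewrite addr_ge0// mulr_ge0.
have le1 : 1 + e <= 1 + l by rewrite lerD2l.
set p := (M.+1 + K')%N in pt *.
have p0 : 0 <= p%:R * dt by rewrite mulr_ge0// dtE dxE mulr_ge0 ?exprn_ge0.
rewrite /interior_error -/p -[V1 *+ p]mulr_natr -[V *+ K]mulr_natr
  -[V1 *+ K']mulr_natr -[V2 *+ K']mulr_natr -[V3 *+ K]mulr_natr
  -[(_ + _) *+ 2]mulr_natr.
have -> : V * (B / e) * (dx * (dt + e)) +
    V1 * p%:R * (B ^+ 2 / e ^+ 3 * (dx ^+ 2 + lam^-1 * dt ^+ 2)) *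
      ((dx + e) * (dt + e)) +
    dx * (O + (V * K%:R + V1 * K'%:R) * 2) +
    dt * (OA + (V2 * K'%:R + V3 * K%:R)) =
    V * B * (e * (e * (1 + lam * e))) +
    V1 * B ^+ 2 * (1 + lam) / lam * (e * ((1 + e) * (1 + lam * e) * (p%:R * dt))) +
    (e ^+ 2 * O + V * 2 * (K%:R * dx) + V1 * 2 / lam * (K'%:R * dt)) +
    (lam * e ^+ 2 * OA + V2 * (K'%:R * dt) + V3 * lam * (K%:R * dx)).
  by rewrite dtE dxE; field; rewrite !gt_eqF.
have le2 : e * (1 + lam * e) <= l * (1 + lam * l) by exact: ler_pM.
have le3 : (1 + e) * (1 + lam * e) * (p%:R * dt) <=
    (1 + l) * (1 + lam * l) * (T + l * (1 + lam * l)).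
  have e1 : 0 <= 1 + e by rewrite addr_ge0.
  by apply: ler_pM => //; [exact: mulr_ge0|exact: ler_pM].
have -> : rate_constant * e =
    V * B * (e * (l * (1 + lam * l))) +
    V1 * B ^+ 2 * (1 + lam) / lam *
      (e * ((1 + l) * (1 + lam * l) * (T + (l * (1 + lam * l))))) +
    (e * l * O + V * 2 * (e * (1 + l)) + V1 * 2 / lam * (e * (1 + lam * l))) +
    (lam * (e * l) * OA + V2 * (e * (1 + lam * l)) + V3 * lam * (e * (1 + l))).
  by rewrite /rate_constant; ring.
have q0 : 0 <= V1 * B ^+ 2 * (1 + lam) / lam.
  by rewrite !mulr_ge0 ?invr_ge0 ?exprn_ge0.
have q1 : 0 <= V1 * 2 / lam by rewrite !mulr_ge0 ?invr_ge0.
apply: lerD; [apply: lerD; [apply: lerD|]|].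
- by rewrite ler_wpM2l ?mulr_ge0// ler_wpM2l.
- by rewrite ler_wpM2l// ler_wpM2l.
- apply: lerD; [apply: lerD|].
  + by rewrite ler_wpM2r.
  + by rewrite ler_wpM2l ?mulr_ge0.
  + by rewrite ler_wpM2l.
- apply: lerD; [apply: lerD|].
  + by rewrite ler_wpM2r// ler_wpM2l.
  + by rewrite ler_wpM2l.
  + by rewrite ler_wpM2l ?mulr_ge0.
Qed.

End rate.

(** * The scheme with the given data *)

Section flux.
Context {R : realType}.
Variable f : R -> R.
Hypothesis f_C1 : C1 f.

Let df (x : R) : is_derive x 1 f (derive1 f x).
Proof. by apply: is_derive1P; case: f_C1. Qed.

Lemma C1_continuous : continuous f.
Proof. by apply: derivable_continuous; case: f_C1. Qed.

Lemma C1_MVT x y : x <= y ->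
  exists2 c, x <= c <= y & f y - f x = derive1 f c * (y - x).
Proof.
move=> xy; have [c cxy E] := MVT_segment xy (fun z _ => df z)
  (continuous_subspaceT C1_continuous).
by exists c.
Qed.

Lemma C1_lipschitz (r : R) : exists2 Lf, 0 <= Lf &
  forall x y, `|x| <= r -> `|y| <= r -> `|f x - f y| <= Lf * `|x - y|.
Proof.
have [r0|r0] := leP 0 r; last first.
  by exists 0 => // x y xr; have := le_lt_trans (le_trans (normr_ge0 x) xr) r0;
    rewrite ltxx.
have cn : {within `[- r, r], continuous (fun x => `|derive1 f x|)}.
  apply: continuous_subspaceT => x.
  apply: (continuous_comp _ (@norm_continuous _ _ _)).
  by case: f_C1 => _; apply.
have [|c _ cmax] := EVT_max _ cn; first by rewrite ge0_cp.
exists `|derive1 f c|; first exact: normr_ge0.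
move=> x y; wlog yx : x y / y <= x.
  move=> H xr yr; have [/H|/ltW/H] := leP y x; first exact.
  by rewrite distrC [`|x - y|]distrC; apply.
move=> xr yr; have [z zyx ->] := C1_MVT yx.
rewrite normrM ler_wpM2r// cmax// in_itv/=.
move: xr yr zyx; rewrite !ler_norml; lra.
Qed.

End flux.

Lemma sum_increments_stop (R : numDomainType) (h : nat -> R) n m :
  (forall j, (n <= j)%N -> h j.+1 = h j) ->
  \sum_(j < m) `|h j.+1 - h j| <= \sum_(j < n) `|h j.+1 - h j|.
Proof.
move=> hn; have [mn|/ltnW nm] := leqP m n.
  by rewrite -(subnKC mn) big_split_ord/= lerDl sumr_ge0.
rewrite -(subnKC nm) big_split_ord/= [X in _ + X]big1 ?addr0// => j _.
by rewrite hn ?leq_addr// subrr normr0.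
Qed.

Section extension.
Context {R : realType}.
Variables (f u0 a : R -> R) (lam dx dt : R) (N M : nat).

Local Notation v := (upwind f u0 a lam dx dt M).

Definition initial_data j : R := v 0 (minn j N.-1).
Definition boundary_data n : R := v (minn n M.+1) 0.

(** The scheme continued past [x = L] and past [t = T] by repeating the last
initial and boundary values: the kernel reaches a little beyond the rectangle. *)
Definition extended_scheme := scheme f lam initial_data boundary_data.

Lemma extended_upwind n j : (n <= M.+1)%N -> (j < N)%N -> extended_scheme n j = v n j.
Proof.
elim: n j => [|n IH] j nM jN.
  have jN' : (j <= N.-1)%N by case: (N) jN.
  by rewrite /extended_scheme/= /initial_data (minn_idPl jN').
case: j jN => [|j] jN; first by rewrite /extended_scheme/= /boundary_data (minn_idPl nM).
by rewrite /extended_scheme/= -/extended_scheme !IH//; exact: ltnW.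
Qed.

Lemma extended0 n : extended_scheme n 0 = boundary_data n.
Proof.
by case: n => //; rewrite /extended_scheme/= /initial_data /boundary_data !min0n.
Qed.

Variables (L T : R).
Hypotheses (dx_gt0 : 0 < dx) (dt_gt0 : 0 < dt) (N_gt0 : (0 < N)%N).
Hypotheses (LE : L = N%:R * dx) (TE : T = M.+1%:R * dt).
Local Notation mu := (@lebesgue_measure R).
Hypotheses (u0_int : mu.-integrable `]0, L[ (EFin \o u0))
  (a_int : mu.-integrable `]0, T[ (EFin \o a)).

Lemma cell_mean_in_data_u0 k : (k < N)%N ->
  data_interval L T u0 a (cell_mean dx u0 k).
Proof.
move=> kN [A B] /= HAB; rewrite in_itv/=.
apply: (cell_mean_ge_le dx_gt0 LE kN u0_int).
have /measurable_EFinP mu0 := measurable_int _ u0_int.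
apply: (ae_imply _ (ess_range_ae mu0 (fun y H => HAB y (or_introl H)))) => x H xL _.
exact: H.
Qed.

Lemma cell_mean_in_data_a k : (k < M.+1)%N ->
  data_interval L T u0 a (cell_mean dt a k).
Proof.
move=> kN [A B] /= HAB; rewrite in_itv/=.
apply: (cell_mean_ge_le dt_gt0 TE kN a_int).
have /measurable_EFinP ma := measurable_int _ a_int.
apply: (ae_imply _ (ess_range_ae ma (fun y H => HAB y (or_intror H)))) => x H xL _.
exact: H.
Qed.

Lemma minn_lt j : (minn j N.-1 < N)%N.
Proof. by rewrite -{2}(prednK N_gt0) ltnS geq_minr. Qed.

Lemma initial_data_in j : data_interval L T u0 a (initial_data j).
Proof. exact/cell_mean_in_data_u0/minn_lt. Qed.

Lemma boundary_data_in n : data_interval L T u0 a (boundary_data n).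
Proof.
rewrite /boundary_data; have := geq_minr n M.+1.
elim: (minn n M.+1) => [|m IH] mM; first exact: cell_mean_in_data_u0.
rewrite /=; case: ifPn => mM'; first exact: cell_mean_in_data_a.
by apply: IH; exact: ltnW.
Qed.

Section variation.
Variables (gt W at_ Wa : R -> R).
Hypotheses (u0_gt : {ae mu, forall x, x \in `]0, L[ -> u0 x = gt x})
  (gtW : forall x y, 0 <= x -> x <= y -> y <= L -> `|gt y - gt x| <= W y - W x).
Hypotheses (a_at : {ae mu, forall x, x \in `]0, T[ -> a x = at_ x})
  (atW : forall x y, 0 <= x -> x <= y -> y <= T -> `|at_ y - at_ x| <= Wa y - Wa x).

Let L_gt0 : 0 < L. Proof. by rewrite LE mulr_gt0// ltr0n. Qed.
Let T_gt0 : 0 < T. Proof. by rewrite TE mulr_gt0// ltr0n. Qed.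

Let B0 := `|gt 0| + (W L - W 0).
Let Ba := `|at_ 0| + (Wa T - Wa 0).

Lemma initial_data_TV m :
  \sum_(j < m) `|initial_data j.+1 - initial_data j| <= (W L - W 0) *+ 3.
Proof.
have NN : (N.-1 < N)%N by rewrite prednK.
apply: le_trans (BV_cell_mean_TV u0_int u0_gt gtW dx_gt0 LE NN).
apply: (le_trans (@sum_increments_stop _ initial_data N.-1 m _)).
  by move=> j Nj; rewrite /initial_data !(minn_idPr _)// leqW.
apply: ler_sum => j _; rewrite /initial_data.
by rewrite (minn_idPl (ltn_ord j)) (minn_idPl (ltnW (ltn_ord j))).
Qed.

(** The value at level 0 is a mean of the initial datum, not of the boundary
datum; the first increment is therefore bounded by the size of the data. *)
Lemma boundary_data_TV m :
  \sum_(n < m) `|boundary_data n.+1 - boundary_data n| <=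
  B0 + Ba + (Wa T - Wa 0) *+ 3.
Proof.
have Wa0 := BV_ge0 T_gt0 atW.
have W0 := BV_ge0 L_gt0 gtW.
apply: (le_trans (@sum_increments_stop _ boundary_data M.+1 m _)).
  by move=> j Mj; rewrite /boundary_data !(minn_idPr _)// leqW.
have bM : boundary_data M.+1 = boundary_data M.
  by rewrite /boundary_data minnn (minn_idPl (leqnSn M))/= ltnn.
have bE n : (0 < n <= M)%N -> boundary_data n = cell_mean dt a n.
  case: n => // n /andP[_ nM]; rewrite /boundary_data (minn_idPl (leqW nM))/=.
  by rewrite nM.
rewrite big_ord_recr/= bM subrr normr0 addr0.
have TVa := BV_cell_mean_TV a_int a_at atW dt_gt0 TE (ltnSn M).
rewrite (le_trans _ (lerD (lexx _) TVa))//.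
have b0 : `|boundary_data 0| <= B0.
  by apply: (BV_cell_mean_bounded u0_int u0_gt gtW dx_gt0 LE).
have b1 : (0 < M)%N -> `|boundary_data 1| <= Ba.
  by move=> M0; rewrite bE ?M0//; exact: (BV_cell_mean_bounded a_int a_at atW dt_gt0 TE).
case: M bE b0 b1 {TVa bM} => [|M'] bE b0 b1.
  by rewrite !big_ord0 addr0 addr_ge0// addr_ge0// normr_ge0.
rewrite !big_ord_recl/=.
rewrite [X in _ + X <= _](_ : _ = \sum_(i < M')
    `|cell_mean dt a (lift ord0 i).+1 - cell_mean dt a (lift ord0 i)|); last first.
  apply: eq_bigr => i _; have iM := ltn_ord i.
  by rewrite (bE (lift ord0 i).+1) ?(bE (lift ord0 i))//= ltnW.
apply: lerD; last by rewrite lerDr.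
by rewrite [leRHS]addrC (le_trans (ler_normB _ _))// lerD// b1.
Qed.

End variation.

End extension.

(** * The convergence rate *)

Lemma cover_cells (R : realType) (e h : R) : 0 <= e -> 0 < h ->
  exists K : nat, e <= K%:R * h /\ K%:R * h <= e + h.
Proof.
move=> e0 h0; exists (Num.truncn (e / h)).+1.
have /andP[] := truncn_itv (divr_ge0 e0 (ltW h0)).
rewrite ler_pdivlMr// ltr_pdivrMr// => te et; split; first exact: ltW.
by rewrite -natr1 mulrDl mul1r lerD2r.
Qed.

Theorem mainTheorem2 (R : realType) (T L alpha lambda : R)
    (f u0 a : R -> R) (u : R -> R -> R)
    (T_gt0 : 0 < T) (L_gt0 : 0 < L)
    (u0_BV : L1_BV 0 L u0) (a_BV : L1_BV 0 T a)
    (f_C1 : C1 f) (alpha_gt0 : 0 < alpha)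
    (f'_ge : forall v : R, alpha <= derive1 f v)
    (u_sol : entropy_solution L T f u0 a u)
    (CFL : forall v : R, data_interval L T u0 a v -> lambda * derive1 f v <= 1) :
  exists C : R,
    forall (N M : nat) (dx dt : R), 0 < dx -> 0 < dt ->
      L = N%:R * dx -> T = M.+1%:R * dt -> dt / dx = lambda ->
      (\int[@lebesgue_measure R]_(x in `]0%R, L[)
         (`|u x T - upwind_approx f u0 a lambda dx dt M x T|)%:E
       <= (C * Num.sqrt dx)%:E)%E.
Proof.
have [lam0|lam_gt0] := leP lambda 0.
  exists 0 => N M dx dt dx0 dt0 _ _ lamE.
  by move: lam0; rewrite -lamE leNgt divr_gt0.
have [th [om [B [[Cth dth th_mono th_le0 th_ge1]
  [B_ge0 om_bnd om_lt0 om_gt1 om_lip]]]]] := @smooth_step R.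
have [u0_int [gt [W [u0_gt gtW]]]] := L1_BV_modulus L_gt0 u0_BV.
have [a_int [at_ [Wa [a_at atW]]]] := L1_BV_modulus T_gt0 a_BV.
have [u_cont u_bnd [gam0 [gamL [[gam0_meas _] _ u_entropy gam0_a]]]] := u_sol.
pose Ou := W L - W 0; pose Oa := Wa T - Wa 0.
have Ou_ge0 : 0 <= Ou by exact: BV_ge0 L_gt0 gtW.
have Oa_ge0 : 0 <= Oa by exact: BV_ge0 T_gt0 atW.
pose Bu := `|gt 0| + Ou; pose Ba := `|at_ 0| + Oa.
have Bu_ge0 : 0 <= Bu by rewrite addr_ge0.
have Ba_ge0 : 0 <= Ba by rewrite addr_ge0.
have [Lf Lf_ge0 f_lip] := C1_lipschitz f_C1 (Bu + Ba).
pose V := Ou *+ 3 + (Bu + Ba + Oa *+ 3).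
have V_ge0 : 0 <= V.
  apply: addr_ge0; first exact: mulrn_wge0.
  by apply: addr_ge0; [exact: addr_ge0|exact: mulrn_wge0].
pose V1 := V *+ 2; pose V2 := V / lambda; pose V3 := V / (lambda * alpha) / lambda.
pose O := Ou *+ 2; pose OA := Lf * (Oa *+ 2 + (Bu + Ba)).
have f_ndecr : {homo f : x y / x <= y}.
  move=> x y xy; have [c _ E] := C1_MVT f_C1 xy.
  by rewrite -subr_ge0 E mulr_ge0 ?subr_ge0// (le_trans (ltW alpha_gt0)).
have f_incr x y : x <= y -> alpha * (y - x) <= f y - f x.
  by move=> xy; have [c _ ->] := C1_MVT f_C1 xy; rewrite ler_wpM2r ?subr_ge0.
have f_cont := C1_continuous f_C1.
pose D := data_interval L T u0 a.
have D_convex x y z : D x -> D y -> x <= z <= y -> D z by exact: data_interval_convex.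
have D_cfl x y : D x -> D y -> x <= y -> lambda * (f y - f x) <= y - x.
  move=> Dx Dy xy; have [c cxy ->] := C1_MVT f_C1 xy.
  rewrite mulrA ler_piMl ?subr_ge0//.
  exact: CFL (D_convex _ _ _ Dx Dy cxy).
exists (rate_constant lambda T B V V1 V2 V3 O OA (Num.sqrt L)).
move=> N M dx dt dx_gt0 dt_gt0 LE TE lamE.
have dtE : dt = lambda * dx by rewrite -lamE divfK// gt_eqF.
have N_gt0 : (0 < N)%N.
  by case: N LE => // L0; rewrite L0 mul0r ltxx in L_gt0.
pose U := initial_data f u0 a lambda dx dt N M.
pose A := boundary_data f u0 a lambda dx dt M.
pose w := extended_scheme f u0 a lambda dx dt N M.
have U_in j : D (U j).
  exact: (initial_data_in f lambda dt M dx_gt0 N_gt0 LE u0_int j).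
have A_in n : D (A n).
  exact: (boundary_data_in f lambda dx_gt0 dt_gt0 N_gt0 LE TE u0_int a_int n).
have data_TV J n : \sum_(j < J) `|U j.+1 - U j| +
    \sum_(m < n) `|w m.+1 0 - w m 0| <= V.
  apply: lerD; first exact: (initial_data_TV f a lambda dt M dx_gt0 N_gt0 LE u0_int u0_gt gtW).
  under eq_bigr do rewrite /w !extended0.
  exact: (boundary_data_TV f lambda dx_gt0 dt_gt0 N_gt0 LE TE u0_int a_int u0_gt gtW a_at atW).
have TV_space := scheme_TV_space lam_gt0 f_ndecr D_convex D_cfl U_in A_in data_TV.
have L1_time := scheme_L1_time lam_gt0 f_ndecr D_convex D_cfl U_in A_in data_TV.
have TV_flux := scheme_TV_time_flux lam_gt0 f_ndecr D_convex D_cfl U_in A_in data_TV.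
have L1_flux := scheme_flux_L1_space lam_gt0 f_ndecr D_convex D_cfl U_in A_in
  data_TV alpha_gt0 f_incr.
have kruzkov := scheme_kruzkov lam_gt0 f_ndecr D_convex D_cfl U_in A_in.
have increment := scheme_time_increment f lam_gt0 U A.
have TV_boundary m : \sum_(n < m) `|w n.+1 0 - w n 0| <= V.
  by have := data_TV 0 m; rewrite big_ord0 add0r.
have TV_time_flux j m : \sum_(n < m) `|f (w n.+1 j) - f (w n j)| <= V2.
  rewrite ler_pdivlMr// mulr_suml (le_trans _ (TV_flux m j))//.
  by apply: ler_sum => n _; rewrite mulrC.
pose e := Num.sqrt dx.
have e_gt0 : 0 < e by rewrite sqrtr_gt0.
have e_le : e <= Num.sqrt L.
  by apply: ler_wsqrtr; rewrite LE ler_peMl ?(ltW dx_gt0)// ler1n.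
have dxE : dx = e ^+ 2 by rewrite sqr_sqrtr// ltW.
have [K [eK Ke]] := cover_cells (ltW e_gt0) dx_gt0.
have [K' [eK' K'e]] := cover_cells (ltW e_gt0) dt_gt0.
pose osc i := if (i < N)%N then cell_osc W dx i *+ 2 else 0.
(* On the first time cell the scheme uses a mean of [u0] instead of a mean of
   [a]; this costs a bounded error on one cell of length [dt]. *)
pose oscA m := if (m < M.+1)%N then
  Lf * (cell_osc Wa dt m *+ 2 + (if m == 0 then Bu + Ba else 0)) else 0.
have osc_ge0 i : 0 <= osc i.
  by rewrite /osc; case: ifP => // iN; rewrite mulrn_wge0// (cell_osc_ge0 gtW dx_gt0 LE).
have oscA_ge0 m : 0 <= oscA m.
  rewrite /oscA; case: ifP => // mM; apply: mulr_ge0 => //; apply: addr_ge0.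
    by rewrite mulrn_wge0// (cell_osc_ge0 atW dt_gt0 TE).
  by case: ifP => // _; exact: addr_ge0.
have sum_osc : \sum_(i < N) osc i <= O.
  rewrite /O /Ou -(sum_cell_osc W LE) -sumrMnl.
  by apply: ler_sum => i _; rewrite /osc ltn_ord.
have sum_oscA : \sum_(m < M.+1) oscA m <= OA.
  rewrite /OA mulrDr /Oa -(sum_cell_osc Wa TE) -sumrMnl mulr_sumr.
  under eq_bigr do rewrite /oscA ltn_ord mulrDr.
  rewrite big_split/= lerD2l big_ord_recl/= big1 ?addr0// => i _.
  by rewrite mulr0.
have wU i : (i < N)%N -> w 0 i = cell_mean dx u0 i.
  by move=> iN; rewrite /w extended_upwind.
have u0_osc i : (i < N)%N -> {ae lebesgue_measure, forall x, x \in `]0, L[ ->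
    i%:R * dx <= x < i.+1%:R * dx -> `|u0 x - w 0 i| <= osc i}.
  move=> iN; apply: (ae_imply _ (BV_cell_dev u0_int u0_gt gtW dx_gt0 LE iN)).
  by move=> x H xL ix; rewrite wU// /osc iN; exact: H.
have a_bnd := BV_bounded a_at atW.
have w0_bnd : `|w 0 0| <= Bu.
  by rewrite wU//; exact: (BV_cell_mean_bounded u0_int u0_gt gtW dx_gt0 LE N_gt0).
have wA m : (0 < m < M.+1)%N -> w m 0 = cell_mean dt a m.
  case: m => // m /andP[_ mM]; have mM' : (m < M)%N := mM.
  by rewrite /w extended_upwind/= ?mM'// ltnW.
have gam0_osc m : (m < M.+1)%N -> {ae lebesgue_measure, forall t, t \in `]0, T[ ->
    m%:R * dt <= t < m.+1%:R * dt -> `|f (gam0 t) - f (w m 0)| <= oscA m}.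
  move=> mM; have dev := BV_cell_dev a_int a_at atW dt_gt0 TE mM.
  apply: (ae_imply2 _ (ae_imply2 (fun x p q => conj p q) gam0_a a_bnd) dev).
  move=> t [ga ab] H tT mt.
  rewrite (ga tT) /oscA mM.
  have mean_bnd := BV_cell_mean_bounded a_int a_at atW dt_gt0 TE mM.
  have w_bnd : `|w m 0| <= Bu + Ba.
    have [->|m0] := eqVneq m 0; first by rewrite (le_trans w0_bnd)// lerDl.
    by rewrite wA ?lt0n ?m0// (le_trans mean_bnd)// lerDr.
  rewrite (le_trans (f_lip _ _ _ w_bnd))//.
    by rewrite (le_trans (ab tT))// lerDr.
  rewrite ler_wpM2l//; case: eqVneq => [m0|m0].
    rewrite m0 in w_bnd *; apply: ler_wpDl.
      by rewrite mulrn_wge0// (cell_osc_ge0 atW dt_gt0 TE).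
    by rewrite [leRHS]addrC (le_trans (ler_normB _ _))// lerD// ab.
  by rewrite addr0 wA ?lt0n ?m0//; exact: H.
have gam0_bnd : exists k : R, {ae lebesgue_measure, forall t, t \in `]0, T[ -> `|gam0 t| <= k}.
  exists Ba; apply: (ae_imply2 _ gam0_a a_bnd) => t ga ab tT.
  by rewrite (ga tT) ab.
have uT_int : lebesgue_measure.-integrable `]0, L[ (fun x => (u x T)%:E).
  by case: u_cont => + _; apply; rewrite in_itv/= lexx ltW.
have err := @error_le R L T f u0 u gam0 gamL L_gt0 T_gt0 f_ndecr f_cont u_bnd
  uT_int u0_int gam0_meas gam0_bnd u_entropy th om B e Cth dth th_mono th_le0
  th_ge1 B_ge0 om_bnd e_gt0 dx dt dx_gt0 dt_gt0 om_lt0 om_gt1 om_lip lambda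
  N M K K' lam_gt0 dtE LE TE eK eK' w kruzkov increment V V1 V2 V3 TV_space
  TV_boundary L1_time TV_time_flux (fun j m => L1_flux m j) osc oscA O OA
  osc_ge0 oscA_ge0 sum_osc sum_oscA u0_osc gam0_osc.
have rate : \int[lebesgue_measure]_(x in `]0, L[)
    `|u x T - step_fun dx N (w M.+1) x| <=
    rate_constant lambda T B V V1 V2 V3 O OA (Num.sqrt L) * e.
  apply: (le_trans err); apply: interior_error_le_rate => //.
  - exact: mulrn_wge0.
  - by rewrite divr_ge0// ltW.
  - by rewrite !divr_ge0// ltW// mulr_gt0.
  - exact: mulrn_wge0.
  - by rewrite mulr_ge0// addr_ge0 ?mulrn_wge0// addr_ge0.
  - by rewrite sqrtr_gt0.
have [Si _] := step_fun_integral L N (w M.+1) dx_gt0.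
have dist_int : lebesgue_measure.-integrable `]0, L[
    (EFin \o (fun x => `|u x T - step_fun dx N (w M.+1) x|)).
  exact: (integrable_norm (integrableB _ uT_int Si)).
rewrite -lee_fin -integrable_fin// in rate.
apply: le_trans rate; rewrite le_eqVlt; apply/orP; left; apply/eqP.
apply: eq_integral => x; rewrite inE/= in_itv/= => /andP[x0 xL].
rewrite LE in xL; have [i iN ix] := cell_index dx_gt0 (ltW x0) xL.
rewrite (step_funE _ dx_gt0 iN ix) /w extended_upwind// /upwind_approx.
have -> : Num.truncn (T / dt) = M.+1 by rewrite TE mulfK ?gt_eqF// natrK.
suff -> : Num.truncn (x / dx) = i by [].
have xi := truncn_itv (divr_ge0 (ltW x0) (ltW dx_gt0)).
apply: (@cell_index_unique _ dx x) => //.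
by rewrite -ler_pdivlMr// -ltr_pdivrMr.
Qed.
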